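(* Let $\mathcal{X}$ and $\mathcal{A}$ be concretely order-regular categories and let $F\dashv G:\mathcal{A}^{\mathrm{op}}\to\mathcal{X}$ be an adjunction (with $F:\mathcal{X}\to\mathcal{A}^{\mathrm{op}}$) such that both $F$ and $G$ preserve exact squares (i.e. $(Fq)^\ast\cdot(Fp)_\ast=(Fg)_\ast\cdot(Ff)^\ast$ for every exact square $p,q,f,g$ in $\mathcal{X}$, and likewise for $G$ on $\mathcal{A}$) and map surjections to embeddings. Define $\mathbb{S}F$ and $\mathbb{S}G$ to agree with $F$ and $G$ on objects and vertical arrows, and on horizontal arrows (relations) by tabulation: for a relation $r$ tabulated by a span $(p:W\to X,q:W\to Y)$, $(a,b)\in\mathbb{S}F(r)$ iff $Fp(a)\le Fq(b)$ in $FW$, and similarly for $\mathbb{S}G$. Then $\mathbb{S}F:\mathbb{S}\mathcal{X}^{\mathrm{co}}\to\mathbb{S}\mathcal{A}^{\mathrm{op}}$ and $\mathbb{S}G:\mathbb{S}\mathcal{A}^{\mathrm{op}}\to\mathbb{S}\mathcal{X}^{\mathrm{co}}$ constitute an adjunction of framed bicategories. Moreover, if $F$ and $G$ are an equivalence, so are $\mathbb{S}F$ and $\mathbb{S}G$.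
   Context: Concretely order-regular category: a locally monotone functor $U:\mathcal{C}\to\mathsf{Pos}$, order-preserving and order-reflecting on homsets, with $\mathcal{C}$ having and $U$ preserving finite poset-enriched (weighted) limits, and with a factorisation system $(\mathcal{E},\mathcal{M})$ lifting uniquely the (surjection, order-embedding) factorisation of posets ($U\mathcal{E}$ = surjections, $U\mathcal{M}$ = embeddings). A weakening relation $R:A\looparrowright B$ of posets is a subset of $A\times B$ with $a'\le aRb\le b'\Rightarrow a'Rb'$; composition is relational ($S\cdot R$ = $R$ then $S$). For $f:A\to B$: $f_\ast=\{(a,b)\mid f(a)\le b\}$, $f^\ast=\{(b,a)\mid b\le f(a)\}$. A $\mathcal{C}$-relation is a weakening relation $UA\looparrowright UB$ whose graph with projections is the $U$-image of a span in $\mathcal{C}$ (which tabulates it). An exact square $p:W\to A_1,q:W\to A_2,f:A_1\to C,g:A_2\to C$: $fp\le gq$ and whenever $Uf(x)\le Ug(y)$ there is $w$ with $x\le Up(w)$, $Uq(w)\le y$. The framed bicategory $\mathbb{S}\mathcal{C}$ is the (strict) double category whose objects are those of $\mathcal{C}$, vertical arrows the arrows of $\mathcal{C}$, horizontal arrows the $\mathcal{C}$-relations (composed relationally), and with a (unique) 2-cell from $S:A\looparrowright B$ to $R:C\looparrowright D$ along vertical $f:A\to C$, $g:B\to D$ iff $S\subseteq R(f,g)$, where $R(f,g)=\{(a,b)\mid (f(a),g(b))\in R\}$ (equivalently $g_\ast\cdot S\subseteq R\cdot f_\ast$); restrictions are given by $R(f,g)$. $\mathbb{S}\mathcal{C}^{\mathrm{co}}$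 reverses 2-cells and $\mathbb{S}\mathcal{C}^{\mathrm{op}}$ reverses vertical arrows. Framed functors, framed transformations and adjunctions of framed bicategories are in the sense of Shulman (''Framed bicategories and monoidal fibrations''): adjunctions in the 2-category of framed bicategories, framed functors and framed transformations. *)

(* Defs.v *)
From Stdlib Require Import Relations FinFun List ProofIrrelevance.
From Stdlib Require Import FunctionalExtensionality IndefiniteDescription.

Set Implicit Arguments.
Unset Strict Implicit.

Record poset := Poset {
  pcar :> Type;
  ple : relation pcar;
  ple_order : order pcar ple }.
Arguments ple {p} _ _.
Infix "⊑" := ple (at level 70, no associativity).

Record mono (A B : poset) := Mono {
  mfun :> A -> B;
  mfun_mono : forall x y, x ⊑ y -> mfun x ⊑ mfun y }.

Lemma ple_refl (A : poset) (x : A) : x ⊑ x.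
Proof. apply (ord_refl _ _ (ple_order A)). Qed.

Lemma ple_trans (A : poset) (x y z : A) : x ⊑ y -> y ⊑ z -> x ⊑ z.
Proof. apply (ord_trans _ _ (ple_order A)). Qed.

Lemma ple_antisym (A : poset) (x y : A) : x ⊑ y -> y ⊑ x -> x = y.
Proof. apply (ord_antisym _ _ (ple_order A)). Qed.

Lemma mono_eq (A B : poset) (f g : mono A B) : (forall x, f x = g x) -> f = g.
Proof.
destruct f as [f Hf], g as [g Hg]; simpl; intros E.
assert (f = g) by (apply functional_extensionality; exact E); subst g.
f_equal; apply proof_irrelevance.
Qed.

Definition order_embedding (A B : poset) (f : mono A B) : Prop :=
  forall x y, f x ⊑ f y -> x ⊑ y.

Record poset_iso (A B : poset) := PosetIso {
  iso_to :> mono A B;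
  iso_from : mono B A;
  iso_to_from : forall y, iso_to (iso_from y) = y;
  iso_from_to : forall x, iso_from (iso_to x) = x }.

Record category := Category {
  ob :> Type;
  hom : ob -> ob -> Type;
  ident : forall A, hom A A;
  comp : forall A B C, hom B C -> hom A B -> hom A C;
  comp_id_l : forall A B (f : hom A B), comp (ident B) f = f;
  comp_id_r : forall A B (f : hom A B), comp f (ident A) = f;
  comp_assoc : forall A B C D (f : hom A B) (g : hom B C) (h : hom C D),
    comp h (comp g f) = comp (comp h g) f }.
Arguments hom {c} _ _.
Arguments ident {c} A.
Arguments comp {c A B C} _ _.
Infix "∘" := comp (at level 40, left associativity).

Definition op (C : category) : category :=
  @Category C (fun A B => hom B A) (fun A => ident A)
    (fun A B D g f => f ∘ g)
    (fun A B f => comp_id_r f) (fun A B f => comp_id_l f)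
    (fun A B D E f g h => eq_sym (comp_assoc h g f)).

Definition is_iso (C : category) (A B : C) (f : hom A B) : Prop :=
  exists g : hom B A, g ∘ f = ident A /\ f ∘ g = ident B.

Record functor (C D : category) := Functor {
  fob :> C -> D;
  fmap : forall A B, hom A B -> hom (fob A) (fob B);
  fmap_id : forall A, fmap (ident A) = ident (fob A);
  fmap_comp : forall A B E (f : hom A B) (g : hom B E),
    fmap (g ∘ f) = fmap g ∘ fmap f }.
Arguments fmap {C D} F {A B} _ : rename.
Arguments fmap_id {C D} F A : rename.
Arguments fmap_comp {C D} F {A B E} f g : rename.

Definition id_functor (C : category) : functor C C :=
  @Functor C C (fun A => A) (fun A B f => f)
    (fun A => eq_refl) (fun A B E f g => eq_refl).

Definition comp_functor (C D E : category) (G : functor D E) (F : functor C D) :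
  functor C E.
Proof.
refine (@Functor C E (fun A => G (F A)) (fun A B f => fmap G (fmap F f)) _ _).
- intros A; rewrite (fmap_id F); apply fmap_id.
- intros A B K f g; rewrite (fmap_comp F); apply fmap_comp.
Defined.

(* A functor C^op -> D, seen as a functor C -> D^op. *)
Definition flip_functor (C D : category) (G : functor (op C) D) : functor C (op D) :=
  @Functor C (op D) (fun A => G A) (fun A B f => @fmap (op C) D G B A f)
    (fun A => fmap_id G A)
    (fun A B E f g => @fmap_comp (op C) D G E B A g f).

Record nat_trans (C D : category) (F G : functor C D) := NatTrans {
  nt :> forall A, hom (F A) (G A);
  nt_natural : forall A B (f : hom A B), nt B ∘ fmap F f = fmap G f ∘ nt A }.

Record adjunction (C D : category) (F : functor C D) (G : functor D C) := Adjunction {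
  adj_unit : nat_trans (id_functor C) (comp_functor G F);
  adj_counit : nat_trans (comp_functor F G) (id_functor D);
  adj_triangle_l : forall A : C, adj_counit (F A) ∘ fmap F (adj_unit A) = ident (F A);
  adj_triangle_r : forall B : D, fmap G (adj_counit B) ∘ adj_unit (G B) = ident (G B) }.

Definition equivalence_pair (C D : category) (F : functor C D) (G : functor D C) : Prop :=
  exists (eta : nat_trans (id_functor C) (comp_functor G F))
         (eps : nat_trans (comp_functor F G) (id_functor D)),
    (forall A, is_iso (eta A)) /\ (forall B, is_iso (eps B)).

Record factorisation_system (C : category)
    (E M : forall A B : C, hom A B -> Prop) : Prop := FactorisationSystem {
  fs_E_iso : forall (A B D : C) (e : hom A B) (h : hom B D),
    E _ _ e -> is_iso h -> E _ _ (h ∘ e);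
  fs_M_iso : forall (A B D : C) (h : hom A B) (m : hom B D),
    is_iso h -> M _ _ m -> M _ _ (m ∘ h);
  fs_factor : forall (A B : C) (f : hom A B),
    exists (I : C) (e : hom A I) (m : hom I B), E _ _ e /\ M _ _ m /\ m ∘ e = f;
  fs_diagonal : forall (A B P Q : C) (e : hom A B) (m : hom P Q)
      (f : hom A P) (g : hom B Q),
    E _ _ e -> M _ _ m -> g ∘ e = m ∘ f ->
    exists! d : hom B P, d ∘ e = f /\ m ∘ d = g }.

Record poscat := PosCat {
  pc_cat :> category;
  hom_le : forall A B : pc_cat, relation (hom A B);
  hom_le_order : forall A B, order (hom A B) (@hom_le A B);
  comp_mono : forall (A B C : pc_cat) (f f' : hom A B) (g g' : hom B C),
    hom_le f f' -> hom_le g g' -> hom_le (g ∘ f) (g' ∘ f') }.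
Arguments hom_le {p A B} _ _.
Infix "⪯" := hom_le (at level 70, no associativity).

Record posfunctor (C D : poscat) := PosFunctor {
  pf_functor :> functor C D;
  pf_mono : forall (A B : C) (f g : hom A B),
    f ⪯ g -> fmap pf_functor f ⪯ fmap pf_functor g }.

Definition comp_posfunctor (C D E : poscat) (G : posfunctor D E) (F : posfunctor C D) :
  posfunctor C E :=
  @PosFunctor C E (comp_functor G F)
    (fun A B f g H => pf_mono G (pf_mono F H)).

Definition mono_id (A : poset) : mono A A := Mono (fun x y (H : x ⊑ y) => H).

Definition mono_comp (A B C : poset) (g : mono B C) (f : mono A B) : mono A C :=
  @Mono A C (fun x => g (f x)) (fun x y H => mfun_mono g (mfun_mono f H)).

Definition PosCategory : category.
Proof.
refine (@Category poset mono mono_id mono_comp _ _ _);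
  intros; apply mono_eq; reflexivity.
Defined.

Definition Pos : poscat.
Proof.
refine (@PosCat PosCategory (fun (A B : poset) (f g : mono A B) => forall x, f x ⊑ g x) _ _).
- intros A B; split.
  + intros f x; apply ple_refl.
  + intros f g h H1 H2 x; exact (ple_trans (H1 x) (H2 x)).
  + intros f g H1 H2; apply mono_eq; intros x; exact (ple_antisym (H1 x) (H2 x)).
- intros A B C f f' g g' H1 H2 x; simpl.
  exact (ple_trans (mfun_mono g (H1 x)) (H2 (f' x))).
Defined.

(* Enriched natural transformations from the weight phi to C(X, T -). *)
Record weighted_cone (C D : poscat) (phi : posfunctor D Pos) (T : posfunctor D C)
    (X : C) := WeightedCone {
  leg : forall d : D, (phi d : poset) -> hom X (T d);
  leg_mono : forall (d : D) (i j : (phi d : poset)), i ⊑ j -> leg i ⪯ leg j;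
  leg_natural : forall (d d' : D) (u : hom d d') (i : (phi d : poset)),
    fmap T u ∘ leg i = leg ((fmap phi u : mono (phi d) (phi d')) i) }.
Arguments leg {C D phi T X} _ _ _.

(* Composition with the cone lam is an order isomorphism from C(X, L) onto the
   poset of weighted cones with vertex X; uniqueness of the mediating arrow
   follows from the second clause by antisymmetry. *)
Definition is_weighted_limit (C D : poscat) (phi : posfunctor D Pos) (T : posfunctor D C)
    (L : C) (lam : weighted_cone phi T L) : Prop :=
  forall X : C,
    (forall mu : weighted_cone phi T X,
       exists h : hom X L, forall d i, leg lam d i ∘ h = leg mu d i) /\
    (forall h h' : hom X L,
       (forall d i, leg lam d i ∘ h ⪯ leg lam d i ∘ h') -> h ⪯ h').

Definition image_cone (C C' D : poscat) (U : posfunctor C C') (phi : posfunctor D Pos)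
    (T : posfunctor D C) (X : C) (mu : weighted_cone phi T X) :
  weighted_cone phi (comp_posfunctor U T) (U X).
Proof.
refine (@WeightedCone C' D phi (comp_posfunctor U T) (U X)
          (fun d i => fmap U (leg mu d i)) _ _).
- intros d i j H; exact (pf_mono U (leg_mono mu H)).
- intros d d' u i; simpl.
  rewrite <- fmap_comp, leg_natural; reflexivity.
Defined.

Definition finite_weight (D : poscat) (phi : posfunctor D Pos) : Prop :=
  Finite D /\ (forall d d' : D, Finite (hom d d')) /\
  (forall d : D, Finite (phi d : poset)).

Definition has_finite_limits (C : poscat) : Prop :=
  forall (D : poscat) (phi : posfunctor D Pos) (T : posfunctor D C),
    finite_weight phi ->
    exists (L : C) (lam : weighted_cone phi T L), is_weighted_limit lam.

Definition preserves_finite_limits (C C' : poscat) (U : posfunctor C C') : Prop :=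
  forall (D : poscat) (phi : posfunctor D Pos) (T : posfunctor D C)
      (L : C) (lam : weighted_cone phi T L),
    finite_weight phi -> is_weighted_limit lam -> is_weighted_limit (image_cone U lam).

Definition is_lift (C : poscat) (U : posfunctor C Pos) (A B : C) (f : hom A B)
    (P : poset) (e : mono (U A) P) (m : mono P (U B))
    (I : C) (e' : hom A I) (m' : hom I B) : Prop :=
  m' ∘ e' = f /\
  exists i : poset_iso (U I) P,
    (forall x, i ((fmap U e' : mono (U A) (U I)) x) = e x) /\
    (forall y, m (i y) = (fmap U m' : mono (U I) (U B)) y).

(* Lifts are taken up to isomorphism of the intermediate poset, and are unique
   up to a unique compatible isomorphism. *)
Definition lifts_factorisations_uniquely (C : poscat) (U : posfunctor C Pos) : Prop :=
  forall (A B : C) (f : hom A B) (P : poset) (e : mono (U A) P) (m : mono P (U B)),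
    Surjective e -> order_embedding m ->
    (forall x, m (e x) = (fmap U f : mono (U A) (U B)) x) ->
    (exists (I : C) (e' : hom A I) (m' : hom I B), is_lift f e m e' m') /\
    (forall (I J : C) (e1 : hom A I) (m1 : hom I B) (e2 : hom A J) (m2 : hom J B),
       is_lift f e m e1 m1 -> is_lift f e m e2 m2 ->
       exists! k : hom I J, is_iso k /\ k ∘ e1 = e2 /\ m2 ∘ k = m1).

(* U E = surjections and U M = embeddings are read as: an arrow belongs to E (to M)
   exactly when its image under U is a surjection (an order-embedding). *)
Record concretely_order_regular := OrderRegular {
  or_cat :> poscat;
  forget : posfunctor or_cat Pos;
  forget_reflects : forall (A B : or_cat) (f g : hom A B),
    fmap forget f ⪯ fmap forget g -> f ⪯ g;
  or_limits : has_finite_limits or_cat;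
  forget_limits : preserves_finite_limits forget;
  or_E : forall A B : or_cat, hom A B -> Prop;
  or_M : forall A B : or_cat, hom A B -> Prop;
  or_factorisation : factorisation_system or_E or_M;
  or_E_surjection : forall (A B : or_cat) (f : hom A B),
    or_E f <-> Surjective (fmap forget f : mono (forget A) (forget B));
  or_M_embedding : forall (A B : or_cat) (f : hom A B),
    or_M f <-> order_embedding (fmap forget f : mono (forget A) (forget B));
  or_lifting : lifts_factorisations_uniquely forget }.
Arguments forget {c}.

Definition under (C : concretely_order_regular) (A : C) : poset := forget A.
Definition app (C : concretely_order_regular) (A B : C) (f : hom A B) : mono (under A) (under B) :=
  fmap forget f.

Record wrel (A B : poset) := WRel {
  wr :> A -> B -> Prop;
  wr_weaken : forall a' a b b', a' ⊑ a -> wr a b -> b ⊑ b' -> wr a' b' }.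

Definition wrel_eq (A B : poset) (R S : wrel A B) : Prop :=
  forall a b, R a b <-> S a b.

(* The relational composite "R, then S", written S · R. *)
Definition wrel_comp (A B C : poset) (S : wrel B C) (R : wrel A B) : wrel A C.
Proof.
refine (@WRel A C (fun a c => exists b, R a b /\ S b c) _).
intros a' a c c' Ha [b [HR HS]] Hc; exists b; split.
- exact (wr_weaken Ha HR (ple_refl b)).
- exact (wr_weaken (ple_refl b) HS Hc).
Defined.
Infix "·" := wrel_comp (at level 40, left associativity).

Definition wrel_id (A : poset) : wrel A A :=
  @WRel A A (fun a b => a ⊑ b)
    (fun a' a b b' H1 H2 H3 => ple_trans H1 (ple_trans H2 H3)).

Definition lower_star (A B : poset) (f : mono A B) : wrel A B :=
  @WRel A B (fun a b => f a ⊑ b)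
    (fun a' a b b' H1 H2 H3 => ple_trans (mfun_mono f H1) (ple_trans H2 H3)).

Definition upper_star (A B : poset) (f : mono A B) : wrel B A :=
  @WRel B A (fun b a => b ⊑ f a)
    (fun a' a b b' H1 H2 H3 => ple_trans H1 (ple_trans H2 (mfun_mono f H3))).

Definition graph (A B : poset) (R : wrel A B) : poset.
Proof.
refine (@Poset {ab : A * B | R (fst ab) (snd ab)}
  (fun x y => fst (proj1_sig x) ⊑ fst (proj1_sig y) /\
              snd (proj1_sig x) ⊑ snd (proj1_sig y)) _).
split.
- intros x; split; apply ple_refl.
- intros x y z [H1 H2] [H3 H4]; split; eapply ple_trans; eassumption.
- intros [[a b] Hx] [[a' b'] Hy] [H1 H2] [H3 H4]; simpl in *.
  assert (a = a') by (apply ple_antisym; assumption).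
  assert (b = b') by (apply ple_antisym; assumption).
  subst a' b'; f_equal; apply proof_irrelevance.
Defined.

Definition graph_fst (A B : poset) (R : wrel A B) : mono (graph R) A :=
  @Mono (graph R) A (fun x => fst (proj1_sig x)) (fun x y H => proj1 H).

Definition graph_snd (A B : poset) (R : wrel A B) : mono (graph R) B :=
  @Mono (graph R) B (fun x => snd (proj1_sig x)) (fun x y H => proj2 H).

Definition tabulates (C : concretely_order_regular) (A B W : C) (p : hom W A) (q : hom W B)
    (R : wrel (under A) (under B)) : Prop :=
  exists i : poset_iso (under W) (graph R),
    (forall w, graph_fst R (i w) = app p w) /\ (forall w, graph_snd R (i w) = app q w).

Record crel (C : concretely_order_regular) (A B : C) := CRel {
  cr :> wrel (under A) (under B);
  cr_tabulated : exists (W : C) (p : hom W A) (q : hom W B), tabulates p q cr }.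

Definition exact_square (C : concretely_order_regular) (W A1 A2 K : C)
    (p : hom W A1) (q : hom W A2) (f : hom A1 K) (g : hom A2 K) : Prop :=
  f ∘ p ⪯ g ∘ q /\
  forall x y, app f x ⊑ app g y -> exists w, x ⊑ app p w /\ app q w ⊑ y.

(* Double categories, weak in the horizontal direction. The category D_0 is
   [vert]; the objects of D_1 are the horizontal arrows; [cell f g M N] is the
   fibre over (f, g) of the set of arrows M -> N of D_1. *)
Record double_data := DoubleData {
  vert :> category;
  hor : vert -> vert -> Type;
  cell : forall A B C D : vert, hom A C -> hom B D -> hor A B -> hor C D -> Type;
  cell_id : forall A B (M : hor A B), cell (ident A) (ident B) M M;
  cell_comp : forall A B C D P Q (f : hom A C) (g : hom B D) (f' : hom C P) (g' : hom D Q)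
    (M : hor A B) (N : hor C D) (K : hor P Q),
    cell f' g' N K -> cell f g M N -> cell (f' ∘ f) (g' ∘ g) M K;
  hunit : forall A, hor A A;
  hunit_cell : forall A C (f : hom A C), cell f f (hunit A) (hunit C);
  hcomp : forall A B C, hor A B -> hor B C -> hor A C;
  hcomp_cell : forall A B C A' B' C' (f : hom A A') (g : hom B B') (h : hom C C')
    (M : hor A B) (N : hor B C) (M' : hor A' B') (N' : hor B' C'),
    cell f g M M' -> cell g h N N' -> cell f h (hcomp M N) (hcomp M' N');
  associator : forall A B C D (M : hor A B) (N : hor B C) (P : hor C D),
    cell (ident A) (ident D) (hcomp (hcomp M N) P) (hcomp M (hcomp N P));
  associator_inv : forall A B C D (M : hor A B) (N : hor B C) (P : hor C D),
    cell (ident A) (ident D) (hcomp M (hcomp N P)) (hcomp (hcomp M N) P);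
  lunitor : forall A B (M : hor A B), cell (ident A) (ident B) (hcomp (hunit A) M) M;
  lunitor_inv : forall A B (M : hor A B), cell (ident A) (ident B) M (hcomp (hunit A) M);
  runitor : forall A B (M : hor A B), cell (ident A) (ident B) (hcomp M (hunit B)) M;
  runitor_inv : forall A B (M : hor A B), cell (ident A) (ident B) M (hcomp M (hunit B)) }.
Arguments hor {d} _ _.
Arguments cell {d A B C D} _ _ _ _.
Arguments cell_id {d A B} M.
Arguments cell_comp {d A B C D P Q f g f' g' M N K} _ _.
Arguments hunit {d} A.
Arguments hunit_cell {d A C} f.
Arguments hcomp {d A B C} _ _.
Arguments hcomp_cell {d A B C A' B' C' f g h M N M' N'} _ _.
Arguments associator {d A B C D} M N P.
Arguments associator_inv {d A B C D} M N P.
Arguments lunitor {d A B} M.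
Arguments lunitor_inv {d A B} M.
Arguments runitor {d A B} M.
Arguments runitor_inv {d A B} M.
Infix "•" := cell_comp (at level 40, left associativity).
Infix "⊙" := hcomp (at level 40, left associativity).
Infix "⊙⊙" := hcomp_cell (at level 40, left associativity).

(* Arrows of D_1, and equality of cells as arrows of D_1. *)
Definition arrow1 (D : double_data) (A B A' B' : D) (M : hor A B) (N : hor A' B') : Type :=
  {fg : hom A A' * hom B B' & cell (fst fg) (snd fg) M N}.

Definition arr (D : double_data) (A B A' B' : D) (M : hor A B) (N : hor A' B')
    (f : hom A A') (g : hom B B') (a : cell f g M N) : arrow1 M N :=
  existT (fun fg : hom A A' * hom B B' => cell (fst fg) (snd fg) M N) (f, g) a.

Definition cell_eq (D : double_data) (A B A' B' : D) (M : hor A B) (N : hor A' B')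
    (f f' : hom A A') (g g' : hom B B') (a : cell f g M N) (b : cell f' g' M N) : Prop :=
  arr a = arr b.
Infix "≈" := cell_eq (at level 70, no associativity).

Record double_laws (D : double_data) : Prop := DoubleLaws {
  cell_id_l : forall (A B A' B' : D) (f : hom A A') (g : hom B B')
    (M : hor A B) (N : hor A' B') (a : cell f g M N), cell_id N • a ≈ a;
  cell_id_r : forall (A B A' B' : D) (f : hom A A') (g : hom B B')
    (M : hor A B) (N : hor A' B') (a : cell f g M N), a • cell_id M ≈ a;
  cell_assoc : forall (A B A1 B1 A2 B2 A3 B3 : D)
    (f1 : hom A A1) (g1 : hom B B1) (f2 : hom A1 A2) (g2 : hom B1 B2)
    (f3 : hom A2 A3) (g3 : hom B2 B3)
    (M : hor A B) (M1 : hor A1 B1) (M2 : hor A2 B2) (M3 : hor A3 B3)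
    (a : cell f1 g1 M M1) (b : cell f2 g2 M1 M2) (c : cell f3 g3 M2 M3),
    c • (b • a) ≈ c • b • a;
  hunit_cell_id : forall A : D, hunit_cell (ident A) ≈ cell_id (hunit A);
  hunit_cell_comp : forall (A B C : D) (f : hom A B) (g : hom B C),
    hunit_cell (g ∘ f) ≈ hunit_cell g • hunit_cell f;
  hcomp_cell_id : forall (A B C : D) (M : hor A B) (N : hor B C),
    cell_id M ⊙⊙ cell_id N ≈ cell_id (M ⊙ N);
  hcomp_cell_comp : forall (A B C A1 B1 C1 A2 B2 C2 : D)
    (f : hom A A1) (g : hom B B1) (h : hom C C1)
    (f' : hom A1 A2) (g' : hom B1 B2) (h' : hom C1 C2)
    (M : hor A B) (N : hor B C) (M1 : hor A1 B1) (N1 : hor B1 C1)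
    (M2 : hor A2 B2) (N2 : hor B2 C2)
    (a : cell f g M M1) (b : cell g h N N1) (a' : cell f' g' M1 M2) (b' : cell g' h' N1 N2),
    (a' • a) ⊙⊙ (b' • b) ≈ (a' ⊙⊙ b') • (a ⊙⊙ b);
  associator_natural : forall (A B C D0 A' B' C' D0' : D)
    (f : hom A A') (g : hom B B') (h : hom C C') (k : hom D0 D0')
    (M : hor A B) (N : hor B C) (P : hor C D0)
    (M' : hor A' B') (N' : hor B' C') (P' : hor C' D0')
    (a : cell f g M M') (b : cell g h N N') (c : cell h k P P'),
    associator M' N' P' • (a ⊙⊙ b ⊙⊙ c) ≈ (a ⊙⊙ (b ⊙⊙ c)) • associator M N P;
  lunitor_natural : forall (A B A' B' : D) (f : hom A A') (g : hom B B')
    (M : hor A B) (M' : hor A' B') (a : cell f g M M'),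
    lunitor M' • (hunit_cell f ⊙⊙ a) ≈ a • lunitor M;
  runitor_natural : forall (A B A' B' : D) (f : hom A A') (g : hom B B')
    (M : hor A B) (M' : hor A' B') (a : cell f g M M'),
    runitor M' • (a ⊙⊙ hunit_cell g) ≈ a • runitor M;
  associator_l : forall (A B C D0 : D) (M : hor A B) (N : hor B C) (P : hor C D0),
    associator_inv M N P • associator M N P ≈ cell_id (M ⊙ N ⊙ P);
  associator_r : forall (A B C D0 : D) (M : hor A B) (N : hor B C) (P : hor C D0),
    associator M N P • associator_inv M N P ≈ cell_id (M ⊙ (N ⊙ P));
  lunitor_l : forall (A B : D) (M : hor A B),
    lunitor_inv M • lunitor M ≈ cell_id (hunit A ⊙ M);
  lunitor_r : forall (A B : D) (M : hor A B), lunitor M • lunitor_inv M ≈ cell_id M;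
  runitor_l : forall (A B : D) (M : hor A B),
    runitor_inv M • runitor M ≈ cell_id (M ⊙ hunit B);
  runitor_r : forall (A B : D) (M : hor A B), runitor M • runitor_inv M ≈ cell_id M;
  pentagon : forall (A B C D0 E : D)
    (M : hor A B) (N : hor B C) (P : hor C D0) (Q : hor D0 E),
    (cell_id M ⊙⊙ associator N P Q) • associator M (N ⊙ P) Q
      • (associator M N P ⊙⊙ cell_id Q)
    ≈ associator M N (P ⊙ Q) • associator (M ⊙ N) P Q;
  triangle : forall (A B C : D) (M : hor A B) (N : hor B C),
    (cell_id M ⊙⊙ lunitor N) • associator M (hunit B) N ≈ runitor M ⊙⊙ cell_id N }.

Definition cartesian (D : double_data) (A B A' B' : D) (f : hom A A') (g : hom B B')
    (M : hor A B) (N : hor A' B') (a : cell f g M N) : Prop :=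
  forall (P Q : D) (h : hom P A) (k : hom Q B) (K : hor P Q)
    (c : cell (f ∘ h) (g ∘ k) K N),
    exists! d : cell h k K M, a • d = c.

Definition opcartesian (D : double_data) (A B A' B' : D) (f : hom A A') (g : hom B B')
    (M : hor A B) (N : hor A' B') (a : cell f g M N) : Prop :=
  forall (P Q : D) (h : hom A' P) (k : hom B' Q) (K : hor P Q)
    (c : cell (h ∘ f) (k ∘ g) M K),
    exists! d : cell h k N K, d • a = c.

(* A double category in which (L, R) : D_1 -> D_0 x D_0 is a bifibration. *)
Record framed_bicategory := FramedBicategory {
  fb_data :> double_data;
  fb_laws : double_laws fb_data;
  fb_cartesian : forall (A B A' B' : fb_data) (f : hom A A') (g : hom B B') (N : hor A' B'),
    exists (M : hor A B) (a : cell f g M N), cartesian a;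
  fb_opcartesian : forall (A B A' B' : fb_data) (f : hom A A') (g : hom B B') (M : hor A B),
    exists (N : hor A' B') (a : cell f g M N), opcartesian a }.

Definition cell_cast (D : double_data) (A B A' B' : D) (M : hor A B) (N : hor A' B')
    (f f' : hom A A') (g g' : hom B B') (ef : f = f') (eg : g = g')
    (a : cell f g M N) : cell f' g' M N :=
  match ef in _ = f0 return cell f0 g' M N with
  | eq_refl => match eg in _ = g0 return cell f g0 M N with eq_refl => a end
  end.

Lemma cell_cast_eq (D : double_data) (A B A' B' : D) (M : hor A B) (N : hor A' B')
    (f f' : hom A A') (g g' : hom B B') (ef : f = f') (eg : g = g') (a : cell f g M N) :
  cell_cast ef eg a ≈ a.
Proof. destruct ef, eg; reflexivity. Qed.

Lemma cell_eq_cast (D : double_data) (A B A' B' : D) (M : hor A B) (N : hor A' B')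
    (f f' : hom A A') (g g' : hom B B') (a : cell f g M N) (b : cell f' g' M N) :
  a ≈ b -> exists (ef : f = f') (eg : g = g'), cell_cast ef eg a = b.
Proof.
intros H; unfold cell_eq in H.
pose (P := fun x : arrow1 M N =>
  exists (ef : f = fst (projT1 x)) (eg : g = snd (projT1 x)),
    cell_cast ef eg a = projT2 x).
change (P (arr b)); rewrite <- H; exists eq_refl, eq_refl; reflexivity.
Qed.

Lemma hcomp_cell_cong (D : double_data) (A B C A' B' C' : D)
    (M : hor A B) (N : hor B C) (M' : hor A' B') (N' : hor B' C')
    (f f1 : hom A A') (g g1 : hom B B') (h h1 : hom C C')
    (a : cell f g M M') (a1 : cell f1 g1 M M') (b : cell g h N N') (b1 : cell g1 h1 N N') :
  a ≈ a1 -> b ≈ b1 -> a ⊙⊙ b ≈ a1 ⊙⊙ b1.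
Proof.
intros Ha Hb; apply cell_eq_cast in Ha; apply cell_eq_cast in Hb.
destruct Ha as [e1 [e2 Ha]], Hb as [e3 [e4 Hb]].
subst f1 g1 h1.
rewrite (proof_irrelevance _ e3 eq_refl) in Hb; simpl in Ha, Hb; subst a1 b1; reflexivity.
Qed.

Definition acomp (D : double_data) (A B A1 B1 A2 B2 : D)
    (M : hor A B) (M1 : hor A1 B1) (M2 : hor A2 B2)
    (b : arrow1 M1 M2) (a : arrow1 M M1) : arrow1 M M2 :=
  arr (projT2 b • projT2 a).

Lemma arr_comp (D : double_data) (A B A1 B1 A2 B2 : D)
    (M : hor A B) (M1 : hor A1 B1) (M2 : hor A2 B2)
    (f : hom A A1) (g : hom B B1) (f' : hom A1 A2) (g' : hom B1 B2)
    (b : cell f' g' M1 M2) (a : cell f g M M1) : arr (b • a) = acomp (arr b) (arr a).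
Proof. reflexivity. Qed.

Lemma acomp_assoc (D : double_data) (HD : double_laws D) (A B A1 B1 A2 B2 A3 B3 : D)
    (M : hor A B) (M1 : hor A1 B1) (M2 : hor A2 B2) (M3 : hor A3 B3)
    (a : arrow1 M M1) (b : arrow1 M1 M2) (c : arrow1 M2 M3) :
  acomp c (acomp b a) = acomp (acomp c b) a.
Proof.
destruct a as [[f g] a], b as [[f1 g1] b], c as [[f2 g2] c]; exact (cell_assoc HD a b c).
Qed.

Lemma acomp_id_l (D : double_data) (HD : double_laws D) (A B A1 B1 : D)
    (M : hor A B) (M1 : hor A1 B1) (a : arrow1 M M1) : acomp (arr (cell_id M1)) a = a.
Proof. destruct a as [[f g] a]; exact (cell_id_l HD a). Qed.

Lemma acomp_id_r (D : double_data) (HD : double_laws D) (A B A1 B1 : D)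
    (M : hor A B) (M1 : hor A1 B1) (a : arrow1 M M1) : acomp a (arr (cell_id M)) = a.
Proof. destruct a as [[f g] a]; exact (cell_id_r HD a). Qed.

Lemma inverse_square (D : double_data) (HD : double_laws D) (A B A1 B1 A2 B2 A3 B3 : D)
    (M : hor A B) (M1 : hor A1 B1) (N : hor A2 B2) (N1 : hor A3 B3)
    (u : arrow1 M M1) (v : arrow1 M1 M) (u' : arrow1 N N1) (v' : arrow1 N1 N)
    (x : arrow1 M N) (y : arrow1 M1 N1) :
  acomp u v = arr (cell_id M1) -> acomp v' u' = arr (cell_id N) ->
  acomp u' x = acomp y u -> acomp x v = acomp v' y.
Proof.
intros H1 H2 H3.
assert (E : x = acomp v' (acomp y u)).
{ rewrite <- H3, (acomp_assoc HD), H2, (acomp_id_l HD); reflexivity. }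
rewrite E, <- !(acomp_assoc HD), H1, (acomp_id_r HD); reflexivity.
Qed.

Lemma inverse_unique (D : double_data) (HD : double_laws D) (A B A1 B1 : D)
    (M : hor A B) (M1 : hor A1 B1) (u u' : arrow1 M M1) (v v' : arrow1 M1 M) :
  acomp v u = arr (cell_id M) -> acomp u' v' = arr (cell_id M1) -> u = u' -> v = v'.
Proof.
intros H1 H2 E; subst u'.
rewrite <- (acomp_id_l HD v'), <- H1, <- (acomp_assoc HD), H2, (acomp_id_r HD); reflexivity.
Qed.

Lemma cell_inverse_square (D : double_data) (HD : double_laws D)
    (A B A1 B1 A2 B2 A3 B3 : D)
    (M : hor A B) (M1 : hor A1 B1) (N : hor A2 B2) (N1 : hor A3 B3)
    (u1 : hom A A1) (u2 : hom B B1) (v1 : hom A1 A) (v2 : hom B1 B)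
    (w1 : hom A2 A3) (w2 : hom B2 B3) (z1 : hom A3 A2) (z2 : hom B3 B2)
    (x1 : hom A A2) (x2 : hom B B2) (y1 : hom A1 A3) (y2 : hom B1 B3)
    (u : cell u1 u2 M M1) (v : cell v1 v2 M1 M)
    (u' : cell w1 w2 N N1) (v' : cell z1 z2 N1 N)
    (x : cell x1 x2 M N) (y : cell y1 y2 M1 N1) :
  u • v ≈ cell_id M1 -> v' • u' ≈ cell_id N -> u' • x ≈ y • u -> x • v ≈ v' • y.
Proof.
exact (@inverse_square D HD _ _ _ _ _ _ _ _ _ _ _ _
         (arr u) (arr v) (arr u') (arr v') (arr x) (arr y)).
Qed.

Lemma cell_inverse_unique (D : double_data) (HD : double_laws D) (A B A1 B1 : D)
    (M : hor A B) (M1 : hor A1 B1)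
    (u1 u1' : hom A A1) (u2 u2' : hom B B1) (v1 v1' : hom A1 A) (v2 v2' : hom B1 B)
    (u : cell u1 u2 M M1) (u' : cell u1' u2' M M1)
    (v : cell v1 v2 M1 M) (v' : cell v1' v2' M1 M) :
  v • u ≈ cell_id M -> u' • v' ≈ cell_id M1 -> u ≈ u' -> v ≈ v'.
Proof.
exact (@inverse_unique D HD _ _ _ _ _ _ (arr u) (arr u') (arr v) (arr v')).
Qed.

Lemma cell_comp_inverse (D : double_data) (HD : double_laws D) (A B A1 B1 A2 B2 : D)
    (M : hor A B) (M1 : hor A1 B1) (M2 : hor A2 B2)
    (u1 : hom A A1) (u2 : hom B B1) (v1 : hom A1 A) (v2 : hom B1 B)
    (w1 : hom A1 A2) (w2 : hom B1 B2) (z1 : hom A2 A1) (z2 : hom B2 B1)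
    (u : cell u1 u2 M M1) (v : cell v1 v2 M1 M)
    (w : cell w1 w2 M1 M2) (z : cell z1 z2 M2 M1) :
  v • u ≈ cell_id M -> z • w ≈ cell_id M1 -> (v • z) • (w • u) ≈ cell_id M.
Proof.
unfold cell_eq; rewrite !arr_comp; intros H1 H2.
rewrite (acomp_assoc HD), <- (acomp_assoc HD (arr w)), H2, (acomp_id_r HD); exact H1.
Qed.

Lemma hcomp_cell_inverse (D : double_data) (HD : double_laws D) (A B C : D)
    (M M1 : hor A B) (N N1 : hor B C)
    (u : cell (ident A) (ident B) M M1) (v : cell (ident A) (ident B) M1 M)
    (w : cell (ident B) (ident C) N N1) (z : cell (ident B) (ident C) N1 N) :
  v • u ≈ cell_id M -> z • w ≈ cell_id N ->
  (v ⊙⊙ z) • (u ⊙⊙ w) ≈ cell_id (M ⊙ N).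
Proof.
intros H1 H2; unfold cell_eq.
rewrite <- (hcomp_cell_id HD M N), <- (hcomp_cell_comp HD u w v z).
exact (hcomp_cell_cong H1 H2).
Qed.

Lemma cell_id_id (D : double_data) (HD : double_laws D) (A B : D) (M : hor A B) :
  cell_id M • cell_id M ≈ cell_id M.
Proof. exact (cell_id_l HD (cell_id M)). Qed.

(* Vertical arrows and 2-cells are both reversed. Reversing only the 2-cells (D^co)
   or only the vertical arrows (E^op) makes L and R contravariant; a framed functor
   D^co -> E^op sends a cell over (f, g) to a cell, in the opposite direction, over
   (F f, F g) read in E, and so is a framed functor D -> coop E. Framed functors
   E^op -> D^co are likewise framed functors coop E -> D. *)
Definition coop_data (D : double_data) : double_data :=
  @DoubleData (op D) (@hor D)
    (fun A B A' B' f g M N => @cell D A' B' A B f g N M)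
    (fun A B M => cell_id M)
    (fun A B A1 B1 A2 B2 f g f' g' M N K b a => a • b)
    (fun A => hunit A) (fun A B f => hunit_cell f)
    (fun A B E M N => M ⊙ N)
    (fun A B E A' B' E' f g h M N M' N' a b => a ⊙⊙ b)
    (fun A B E K M N P => associator_inv M N P) (fun A B E K M N P => associator M N P)
    (fun A B M => lunitor_inv M) (fun A B M => lunitor M)
    (fun A B M => runitor_inv M) (fun A B M => runitor M).

Lemma coop_laws (D : double_data) : double_laws D -> double_laws (coop_data D).
Proof.
intros HD; split.
- intros A B A' B' f g M N a; exact (cell_id_r HD a).
- intros A B A' B' f g M N a; exact (cell_id_l HD a).
- intros; exact (eq_sym (cell_assoc HD c b a)).
- intros; exact (hunit_cell_id HD A).
- intros; exact (hunit_cell_comp HD g f).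
- intros; exact (hcomp_cell_id HD M N).
- intros; exact (hcomp_cell_comp HD a' b' a b).
- intros A B C D0 A' B' C' D0' f g h k M N P M' N' P' a b c.
  exact (cell_inverse_square HD (associator_r HD M' N' P') (associator_l HD M N P)
           (associator_natural HD a b c)).
- intros A B A' B' f g M M' a.
  exact (cell_inverse_square HD (lunitor_r HD M') (lunitor_l HD M) (lunitor_natural HD a)).
- intros A B A' B' f g M M' a.
  exact (cell_inverse_square HD (runitor_r HD M') (runitor_l HD M) (runitor_natural HD a)).
- intros; exact (associator_l HD M N P).
- intros; exact (associator_r HD M N P).
- intros; exact (lunitor_l HD M).
- intros; exact (lunitor_r HD M).
- intros; exact (runitor_l HD M).
- intros; exact (runitor_r HD M).
- intros A B C D0 E M N P Q.
  refine (cell_inverse_unique HD _ _ (pentagon HD M N P Q)).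
  + refine (cell_comp_inverse HD _ _).
    * exact (hcomp_cell_inverse HD (associator_l HD M N P) (cell_id_id HD Q)).
    * exact (cell_comp_inverse HD (associator_l HD M (N ⊙ P) Q)
        (hcomp_cell_inverse HD (cell_id_id HD M) (associator_l HD N P Q))).
  + exact (cell_comp_inverse HD (associator_r HD M N (P ⊙ Q))
             (associator_r HD (M ⊙ N) P Q)).
- intros A B C M N.
  refine (cell_inverse_unique HD _ _ (triangle HD M N)).
  + exact (cell_comp_inverse HD (associator_l HD M (hunit B) N)
        (hcomp_cell_inverse HD (cell_id_id HD M) (lunitor_l HD N))).
  + exact (hcomp_cell_inverse HD (runitor_r HD M) (cell_id_id HD N)).
Qed.

Definition coop (D : framed_bicategory) : framed_bicategory :=
  @FramedBicategory (coop_data D) (coop_laws (fb_laws D))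
    (fun A B A' B' f g N => @fb_opcartesian D A' B' A B f g N)
    (fun A B A' B' f g M => @fb_cartesian D A' B' A B f g M).

(* Strong double functors with vertical part F. *)
Record framed_functor (D E : framed_bicategory) (F : functor D E) := FramedFunctor {
  ff_hor : forall A B : D, hor A B -> hor (F A) (F B);
  ff_cell : forall (A B A' B' : D) (f : hom A A') (g : hom B B')
    (M : hor A B) (N : hor A' B'),
    cell f g M N -> cell (fmap F f) (fmap F g) (ff_hor M) (ff_hor N);
  ff_comp : forall (A B C : D) (M : hor A B) (N : hor B C),
    cell (ident (F A)) (ident (F C)) (ff_hor M ⊙ ff_hor N) (ff_hor (M ⊙ N));
  ff_comp_inv : forall (A B C : D) (M : hor A B) (N : hor B C),
    cell (ident (F A)) (ident (F C)) (ff_hor (M ⊙ N)) (ff_hor M ⊙ ff_hor N);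
  ff_unit : forall A : D,
    cell (ident (F A)) (ident (F A)) (hunit (F A)) (ff_hor (hunit A));
  ff_unit_inv : forall A : D,
    cell (ident (F A)) (ident (F A)) (ff_hor (hunit A)) (hunit (F A));
  ff_cell_id : forall (A B : D) (M : hor A B),
    ff_cell (cell_id M) ≈ cell_id (ff_hor M);
  ff_cell_comp : forall (A B A1 B1 A2 B2 : D)
    (f : hom A A1) (g : hom B B1) (f' : hom A1 A2) (g' : hom B1 B2)
    (M : hor A B) (M1 : hor A1 B1) (M2 : hor A2 B2)
    (a : cell f g M M1) (b : cell f' g' M1 M2),
    ff_cell (b • a) ≈ ff_cell b • ff_cell a;
  ff_comp_natural : forall (A B C A' B' C' : D)
    (f : hom A A') (g : hom B B') (h : hom C C')
    (M : hor A B) (N : hor B C) (M' : hor A' B') (N' : hor B' C')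
    (a : cell f g M M') (b : cell g h N N'),
    ff_comp M' N' • (ff_cell a ⊙⊙ ff_cell b) ≈ ff_cell (a ⊙⊙ b) • ff_comp M N;
  ff_unit_natural : forall (A A' : D) (f : hom A A'),
    ff_unit A' • hunit_cell (fmap F f) ≈ ff_cell (hunit_cell f) • ff_unit A;
  ff_comp_l : forall (A B C : D) (M : hor A B) (N : hor B C),
    ff_comp_inv M N • ff_comp M N ≈ cell_id (ff_hor M ⊙ ff_hor N);
  ff_comp_r : forall (A B C : D) (M : hor A B) (N : hor B C),
    ff_comp M N • ff_comp_inv M N ≈ cell_id (ff_hor (M ⊙ N));
  ff_unit_l : forall A : D, ff_unit_inv A • ff_unit A ≈ cell_id (hunit (F A));
  ff_unit_r : forall A : D, ff_unit A • ff_unit_inv A ≈ cell_id (ff_hor (hunit A));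
  ff_associator : forall (A B C K : D) (M : hor A B) (N : hor B C) (P : hor C K),
    ff_cell (associator M N P) • ff_comp (M ⊙ N) P • (ff_comp M N ⊙⊙ cell_id (ff_hor P))
    ≈ ff_comp M (N ⊙ P) • (cell_id (ff_hor M) ⊙⊙ ff_comp N P)
        • associator (ff_hor M) (ff_hor N) (ff_hor P);
  ff_lunitor : forall (A B : D) (M : hor A B),
    ff_cell (lunitor M) • ff_comp (hunit A) M • (ff_unit A ⊙⊙ cell_id (ff_hor M))
    ≈ lunitor (ff_hor M);
  ff_runitor : forall (A B : D) (M : hor A B),
    ff_cell (runitor M) • ff_comp M (hunit B) • (cell_id (ff_hor M) ⊙⊙ ff_unit B)
    ≈ runitor (ff_hor M) }.
Arguments ff_hor {D E F} S {A B} _ : rename.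
Arguments ff_cell {D E F} S {A B A' B' f g M N} _ : rename.
Arguments ff_comp {D E F} S {A B C} M N : rename.
Arguments ff_comp_inv {D E F} S {A B C} M N : rename.
Arguments ff_unit {D E F} S A : rename.
Arguments ff_unit_inv {D E F} S A : rename.

Lemma ff_cell_cong (D E : framed_bicategory) (F : functor D E) (S : framed_functor F)
    (A B A' B' : D) (M : hor A B) (N : hor A' B')
    (f f' : hom A A') (g g' : hom B B') (a : cell f g M N) (b : cell f' g' M N) :
  a ≈ b -> ff_cell S a ≈ ff_cell S b.
Proof.
intros H; apply cell_eq_cast in H; destruct H as [e1 [e2 H]].
subst f' g'; simpl in H; subst b; reflexivity.
Qed.

Definition id_framed_functor (D : framed_bicategory) : framed_functor (id_functor D).
Proof.
pose proof (fb_laws D) as HD.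
refine (@FramedFunctor D D (id_functor D)
  (fun A B M => M) (fun A B A' B' f g M N a => a)
  (fun A B C M N => cell_id (M ⊙ N)) (fun A B C M N => cell_id (M ⊙ N))
  (fun A => cell_id (hunit A)) (fun A => cell_id (hunit A)) _ _ _ _ _ _ _ _ _ _ _);
  intros; unfold cell_eq; simpl; rewrite ?arr_comp.
- reflexivity.
- reflexivity.
- rewrite (acomp_id_l HD), (acomp_id_r HD); reflexivity.
- rewrite (acomp_id_l HD), (acomp_id_r HD); reflexivity.
- apply (acomp_id_l HD).
- apply (acomp_id_l HD).
- apply (acomp_id_l HD).
- apply (acomp_id_l HD).
- rewrite !(hcomp_cell_id HD), !(acomp_id_r HD), !(acomp_id_l HD); reflexivity.
- rewrite !(hcomp_cell_id HD), !(acomp_id_r HD); reflexivity.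
- rewrite !(hcomp_cell_id HD), !(acomp_id_r HD); reflexivity.
Defined.

Lemma fmap_ident_comp (C D : category) (F : functor C D) (A : C) :
  fmap F (ident A) ∘ ident (F A) = ident (F A).
Proof. rewrite fmap_id; apply comp_id_l. Qed.

Lemma comp_fmap_ident (C D : category) (F : functor C D) (A : C) :
  ident (F A) ∘ fmap F (ident A) = ident (F A).
Proof. rewrite fmap_id; apply comp_id_l. Qed.

Lemma hcomp_left (E K : framed_bicategory) (G : functor E K) (T : framed_functor G)
    (A B C : E) (M M' : hor A B) (N : hor B C) (L : hor (G A) (G B))
    (x : cell (ident (G A)) (ident (G B)) L (ff_hor T M'))
    (a : cell (ident A) (ident B) M M') (b : cell (ident (G A)) (ident (G B)) L (ff_hor T M)) :
  x ≈ ff_cell T a • b ->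
  arr (x ⊙⊙ cell_id (ff_hor T N))
  = acomp (arr (ff_cell T a ⊙⊙ ff_cell T (cell_id N))) (arr (b ⊙⊙ cell_id (ff_hor T N))).
Proof.
intros H; pose proof (fb_laws K) as HK.
rewrite <- arr_comp, <- (hcomp_cell_comp HK).
refine (hcomp_cell_cong H _).
unfold cell_eq; rewrite arr_comp, (ff_cell_id T), (acomp_id_l HK); reflexivity.
Qed.

Lemma hcomp_right (E K : framed_bicategory) (G : functor E K) (T : framed_functor G)
    (A B C : E) (M : hor A B) (N N' : hor B C) (L : hor (G B) (G C))
    (x : cell (ident (G B)) (ident (G C)) L (ff_hor T N'))
    (a : cell (ident B) (ident C) N N') (b : cell (ident (G B)) (ident (G C)) L (ff_hor T N)) :
  x ≈ ff_cell T a • b ->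
  arr (cell_id (ff_hor T M) ⊙⊙ x)
  = acomp (arr (ff_cell T (cell_id M) ⊙⊙ ff_cell T a)) (arr (cell_id (ff_hor T M) ⊙⊙ b)).
Proof.
intros H; pose proof (fb_laws K) as HK.
rewrite <- arr_comp, <- (hcomp_cell_comp HK).
refine (hcomp_cell_cong _ H).
unfold cell_eq; rewrite arr_comp, (ff_cell_id T), (acomp_id_l HK); reflexivity.
Qed.

Definition comp_framed_functor (D E K : framed_bicategory) (G : functor E K)
    (F : functor D E) (T : framed_functor G) (S : framed_functor F) :
  framed_functor (comp_functor G F).
Proof.
pose proof (fb_laws D) as HD; pose proof (fb_laws E) as HE; pose proof (fb_laws K) as HK.
refine (@FramedFunctor D K (comp_functor G F)
  (fun A B M => ff_hor T (ff_hor S M))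
  (fun A B A' B' f g M N a => ff_cell T (ff_cell S a))
  (fun A B C M N => cell_cast (fmap_ident_comp G (F A)) (fmap_ident_comp G (F C))
     (ff_cell T (ff_comp S M N) • ff_comp T (ff_hor S M) (ff_hor S N)))
  (fun A B C M N => cell_cast (comp_fmap_ident G (F A)) (comp_fmap_ident G (F C))
     (ff_comp_inv T (ff_hor S M) (ff_hor S N) • ff_cell T (ff_comp_inv S M N)))
  (fun A => cell_cast (fmap_ident_comp G (F A)) (fmap_ident_comp G (F A))
     (ff_cell T (ff_unit S A) • ff_unit T (F A)))
  (fun A => cell_cast (comp_fmap_ident G (F A)) (comp_fmap_ident G (F A))
     (ff_unit_inv T (F A) • ff_cell T (ff_unit_inv S A))) _ _ _ _ _ _ _ _ _ _ _);
  intros; unfold cell_eq; cbn [fob fmap comp_functor];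
  rewrite ?arr_comp, ?cell_cast_eq, ?arr_comp.
- rewrite <- (ff_cell_id T); exact (ff_cell_cong T (ff_cell_id S M)).
- rewrite <- arr_comp, <- (ff_cell_comp T); exact (ff_cell_cong T (ff_cell_comp S a b)).
- rewrite <- (acomp_assoc HK), <- arr_comp.
  rewrite (ff_comp_natural T (ff_cell S a) (ff_cell S b)), arr_comp, !(acomp_assoc HK).
  f_equal; rewrite <- !arr_comp, <- !(ff_cell_comp T).
  exact (ff_cell_cong T (ff_comp_natural S a b)).
- rewrite <- (acomp_assoc HK), <- arr_comp.
  rewrite (ff_unit_natural T (fmap F f)), arr_comp, !(acomp_assoc HK).
  f_equal; rewrite <- !arr_comp, <- !(ff_cell_comp T).
  exact (ff_cell_cong T (ff_unit_natural S f)).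
- rewrite (acomp_assoc HK), <- (acomp_assoc HK (arr (ff_cell T (ff_comp S M N)))).
  rewrite <- (arr_comp (ff_cell T _) (ff_cell T _)), <- (ff_cell_comp T).
  rewrite (ff_cell_cong T (ff_comp_l S M N)), (ff_cell_id T), (acomp_id_r HK).
  exact (ff_comp_l T _ _).
- rewrite (acomp_assoc HK), <- (acomp_assoc HK (arr (ff_comp_inv T _ _))).
  rewrite <- (arr_comp (ff_comp T _ _)), (ff_comp_r T), (acomp_id_r HK).
  rewrite <- arr_comp, <- (ff_cell_comp T), (ff_cell_cong T (ff_comp_r S M N)).
  exact (ff_cell_id T _).
- rewrite (acomp_assoc HK), <- (acomp_assoc HK (arr (ff_cell T (ff_unit S A)))).
  rewrite <- (arr_comp (ff_cell T _) (ff_cell T _)), <- (ff_cell_comp T).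
  rewrite (ff_cell_cong T (ff_unit_l S A)), (ff_cell_id T), (acomp_id_r HK).
  exact (ff_unit_l T _).
- rewrite (acomp_assoc HK), <- (acomp_assoc HK (arr (ff_unit_inv T _))).
  rewrite <- (arr_comp (ff_unit T _)), (ff_unit_r T), (acomp_id_r HK).
  rewrite <- arr_comp, <- (ff_cell_comp T), (ff_cell_cong T (ff_unit_r S A)).
  exact (ff_cell_id T _).
- rewrite (hcomp_left (T := T) (ff_hor S P) (cell_cast_eq _ _ _)).
  rewrite (hcomp_right (T := T) (ff_hor S M) (cell_cast_eq _ _ _)).
  rewrite <- !(acomp_assoc HK).
  rewrite (acomp_assoc HK _ (arr (ff_cell T (ff_comp S M N) ⊙⊙ _))).
  rewrite <- (arr_comp (ff_comp T _ _)), (ff_comp_natural T), arr_comp.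
  rewrite (acomp_assoc HK _ (arr (_ ⊙⊙ ff_cell T (ff_comp S N P)))).
  rewrite <- (arr_comp (ff_comp T _ _) (_ ⊙⊙ ff_cell T (ff_comp S N P))).
  rewrite (ff_comp_natural T (cell_id _) (ff_comp S N P)), arr_comp.
  pose proof (ff_associator T (ff_hor S M) (ff_hor S N) (ff_hor S P)) as H1.
  pose proof (ff_cell_cong T (ff_associator S M N P)) as H2.
  unfold cell_eq in H1, H2; rewrite !(ff_cell_comp T), !arr_comp in H2.
  rewrite !(ff_cell_comp T), !arr_comp in H2.
  rewrite !arr_comp in H1.
  rewrite !(acomp_assoc HK), H2, <- !(acomp_assoc HK).
  rewrite <- !(acomp_assoc HK) in H1; rewrite H1; reflexivity.
- rewrite (hcomp_left (T := T) (ff_hor S M) (cell_cast_eq _ _ _)).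
  rewrite <- !(acomp_assoc HK).
  rewrite (acomp_assoc HK _ (arr (ff_cell T (ff_unit S A) ⊙⊙ _))).
  rewrite <- (arr_comp (ff_comp T _ _)), (ff_comp_natural T), arr_comp.
  pose proof (ff_lunitor T (ff_hor S M)) as H1.
  pose proof (ff_cell_cong T (ff_lunitor S M)) as H2.
  unfold cell_eq in H1, H2; rewrite !(ff_cell_comp T), !arr_comp in H2.
  rewrite !(ff_cell_comp T), !arr_comp in H2.
  rewrite !(acomp_assoc HK), H2; exact H1.
- rewrite (hcomp_right (T := T) (ff_hor S M) (cell_cast_eq _ _ _)).
  rewrite <- !(acomp_assoc HK).
  rewrite (acomp_assoc HK _ (arr (_ ⊙⊙ ff_cell T (ff_unit S B)))).
  rewrite <- (arr_comp (ff_comp T _ _)), (ff_comp_natural T), arr_comp.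
  pose proof (ff_runitor T (ff_hor S M)) as H1.
  pose proof (ff_cell_cong T (ff_runitor S M)) as H2.
  unfold cell_eq in H1, H2; rewrite !(ff_cell_comp T), !arr_comp in H2.
  rewrite !(ff_cell_comp T), !arr_comp in H2.
  rewrite !(acomp_assoc HK), H2; exact H1.
Defined.

Record framed_trans (D E : framed_bicategory) (F G : functor D E)
    (S : framed_functor F) (T : framed_functor G) := FramedTrans {
  ft_vert :> nat_trans F G;
  ft_cell : forall (A B : D) (M : hor A B),
    cell (ft_vert A) (ft_vert B) (ff_hor S M) (ff_hor T M);
  ft_natural : forall (A B A' B' : D) (f : hom A A') (g : hom B B')
    (M : hor A B) (N : hor A' B') (a : cell f g M N),
    ft_cell N • ff_cell S a ≈ ff_cell T a • ft_cell M;
  ft_comp : forall (A B C : D) (M : hor A B) (N : hor B C),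
    ft_cell (M ⊙ N) • ff_comp S M N ≈ ff_comp T M N • (ft_cell M ⊙⊙ ft_cell N);
  ft_unit : forall A : D,
    ft_cell (hunit A) • ff_unit S A ≈ ff_unit T A • hunit_cell (ft_vert A) }.
Arguments ft_cell {D E F G S T} a {A B} M : rename.

(* Adjunctions in the 2-category of framed bicategories: the triangle identities
   are written out on objects and on horizontal arrows. *)
Record framed_adjunction (D E : framed_bicategory) (F : functor D E) (G : functor E D)
    (S : framed_functor F) (T : framed_functor G) := FramedAdjunction {
  fa_unit : framed_trans (id_framed_functor D) (comp_framed_functor T S);
  fa_counit : framed_trans (comp_framed_functor S T) (id_framed_functor E);
  fa_triangle_l : forall A : D, fa_counit (F A) ∘ fmap F (fa_unit A) = ident (F A);
  fa_triangle_l_cell : forall (A B : D) (M : hor A B),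
    ft_cell fa_counit (ff_hor S M) • ff_cell S (ft_cell fa_unit M) ≈ cell_id (ff_hor S M);
  fa_triangle_r : forall A : E, fmap G (fa_counit A) ∘ fa_unit (G A) = ident (G A);
  fa_triangle_r_cell : forall (A B : E) (M : hor A B),
    ff_cell T (ft_cell fa_counit M) • ft_cell fa_unit (ff_hor T M) ≈ cell_id (ff_hor T M) }.

Definition framed_trans_invertible (D E : framed_bicategory) (F G : functor D E)
    (S : framed_functor F) (T : framed_functor G) (a : framed_trans S T) : Prop :=
  exists b : framed_trans T S,
    (forall A, b A ∘ a A = ident (F A) /\ a A ∘ b A = ident (G A)) /\
    (forall (A B : D) (M : hor A B),
       ft_cell b M • ft_cell a M ≈ cell_id (ff_hor S M) /\
       ft_cell a M • ft_cell b M ≈ cell_id (ff_hor T M)).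

Definition framed_equivalence_pair (D E : framed_bicategory) (F : functor D E)
    (G : functor E D) (S : framed_functor F) (T : framed_functor G) : Prop :=
  exists (eta : framed_trans (id_framed_functor D) (comp_framed_functor T S))
         (eps : framed_trans (comp_framed_functor S T) (id_framed_functor E)),
    framed_trans_invertible eta /\ framed_trans_invertible eps.

Lemma app_id (C : concretely_order_regular) (A : C) (x : under A) : app (ident A) x = x.
Proof. unfold app; rewrite (fmap_id forget); reflexivity. Qed.

Lemma app_comp (C : concretely_order_regular) (A B K : C) (f : hom A B) (g : hom B K)
    (x : under A) :
  app (g ∘ f) x = app g (app f x).
Proof. unfold app; rewrite (fmap_comp forget); reflexivity. Qed.

Lemma app_le (C : concretely_order_regular) (A B : C) (f g : hom A B)
    (x : under A) :
  f ⪯ g -> app f x ⊑ app g x.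
Proof. intros H; exact (pf_mono forget H x). Qed.

Definition one_poset : poset.
Proof.
refine (@Poset unit (fun _ _ => True) _).
split; [intros x; exact I | intros x y z _ _; exact I | intros [] [] _ _; reflexivity].
Defined.

Definition two_poset : poset.
Proof.
refine (@Poset bool (fun x y => x = true -> y = true) _); split.
- intros x H; exact H.
- intros x y z H1 H2 H; auto.
- intros [] [] H1 H2; auto; symmetry; auto.
Defined.

Definition mono_const (A B : poset) (b : B) : mono A B :=
  @Mono A B (fun _ => b) (fun _ _ _ => ple_refl b).

Definition discrete_poscat (C : category) : poscat.
Proof.
refine (@PosCat C (fun A B f g => f = g) _ _).
- intros A B; split; [intros x; reflexivity | intros x y z -> ->; reflexivity |].
  intros x y H _; exact H.
- intros A B K f f' g g' -> ->; reflexivity.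
Defined.

Definition pair_category : category.
Proof.
refine (@Category bool (fun x y => x = y) (fun x => eq_refl)
  (fun x y z g f => eq_trans f g) _ _ _).
- intros x y []; reflexivity.
- intros x y []; reflexivity.
- intros x y z w [] [] []; reflexivity.
Defined.

Definition pair_functor (C : poscat) (A B : C) : posfunctor (discrete_poscat pair_category) C.
Proof.
unshelve refine (@PosFunctor (discrete_poscat pair_category) C
  (@Functor pair_category C (fun x => if x : bool then A else B)
  (fun x y e => match e in _ = y0
     return hom (if x then A else B) (if y0 : bool then A else B)
     with eq_refl => ident _ end) _ _) _).
- intros x; reflexivity.
- intros x y z [] []; simpl; symmetry; apply comp_id_l.
- intros x y f g H; simpl in H; rewrite H; apply (ord_refl _ _ (hom_le_order _ _)).
Defined.

Definition pair_weight : posfunctor (discrete_poscat pair_category) Pos.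
Proof.
unshelve refine (@PosFunctor (discrete_poscat pair_category) Pos
  (@Functor pair_category Pos (fun x => one_poset) (fun x y e => mono_id one_poset) _ _) _).
- intros x; reflexivity.
- intros x y z f g; apply mono_eq; reflexivity.
- intros x y f g H z; apply ple_refl.
Defined.

Lemma pair_weight_finite : finite_weight pair_weight.
Proof.
split; [|split].
- exists (true :: false :: nil)%list; intros []; simpl; auto.
- intros d d'; destruct (Bool.bool_dec d d') as [e|n].
  + exists (e :: nil)%list; intros x; left; exact (proof_irrelevance (d = d') e x).
  + exists nil; intros x; destruct (n x).
- intros d; exists (tt :: nil)%list; intros []; left; reflexivity.
Qed.

Lemma product_exists (C : concretely_order_regular) (A B : C) :
  exists (K : C) (p : hom K A) (q : hom K B),
    (forall (X : C) (f : hom X A) (g : hom X B),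
       exists h : hom X K, p ∘ h = f /\ q ∘ h = g) /\
    (forall w w' : under K, app p w ⊑ app p w' -> app q w ⊑ app q w' -> w ⊑ w').
Proof.
destruct (or_limits (pair_functor A B) pair_weight_finite) as [K [lam Hlam]].
exists K, (leg lam true tt), (leg lam false tt); split.
- intros X f g.
  unshelve epose (mu := @WeightedCone C _ pair_weight (pair_functor A B) X
    (fun d => match d return unit -> hom X (if d : bool then A else B) with
              | true => fun _ => f | false => fun _ => g end) _ _).
  + intros [] i j _; apply (ord_refl _ _ (hom_le_order _ _)).
  + intros d d' []; destruct d; intros i; apply comp_id_l.
  + destruct (proj1 (Hlam X) mu) as [h Hh].
    exists h; split; [exact (Hh true tt) | exact (Hh false tt)].
- intros w w' H1 H2.
  pose proof (forget_limits pair_weight_finite Hlam) as HU.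
  refine (proj2 (HU one_poset) (@mono_const one_poset (under K) w)
    (@mono_const one_poset (under K) w') _ tt).
  intros [] [] x; [exact H1 | exact H2].
Qed.

Inductive cospan_shape := cs_left | cs_right | cs_apex.

Definition cospan_hom (x y : cospan_shape) : Type :=
  match x, y with
  | cs_left, cs_left | cs_right, cs_right | cs_apex, cs_apex
  | cs_left, cs_apex | cs_right, cs_apex => unit
  | _, _ => Empty_set
  end.

Definition cospan_category : category.
Proof.
unshelve refine (@Category cospan_shape cospan_hom _ _ _ _ _).
- intros []; exact tt.
- intros [] [] []; simpl; intros f g;
    first [exact tt | destruct f; fail | destruct g; fail | exact f | exact g].
- intros [] []; simpl; intros []; reflexivity.
- intros [] []; simpl; intros []; reflexivity.
- intros [] [] [] []; simpl; intros [] [] []; reflexivity.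
Defined.

Definition cospan_functor (C : poscat) (A B K : C) (f : hom A K) (g : hom B K) :
  posfunctor (discrete_poscat cospan_category) C.
Proof.
unshelve refine (@PosFunctor (discrete_poscat cospan_category) C
  (@Functor cospan_category C
     (fun x => match x with cs_left => A | cs_right => B | cs_apex => K end) _ _ _) _).
- intros x y; destruct x, y; simpl; intros e;
    first [exact (ident _) | exact f | exact g | destruct e].
- intros []; reflexivity.
- intros x y z; destruct x, y, z; simpl; intros [] []; symmetry;
    first [apply comp_id_l | apply comp_id_r].
- intros x y u v H; simpl in H; rewrite H; apply (ord_refl _ _ (hom_le_order _ _)).
Defined.

Definition comma_weight : posfunctor (discrete_poscat cospan_category) Pos.
Proof.
unshelve refine (@PosFunctor (discrete_poscat cospan_category) Pos
  (@Functor cospan_category Pos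
     (fun x => match x with cs_apex => two_poset | _ => one_poset end) _ _ _) _).
- intros x y; destruct x, y; simpl; intros e; try destruct e.
  + exact (mono_id one_poset).
  + exact (@mono_const one_poset two_poset false).
  + exact (mono_id one_poset).
  + exact (@mono_const one_poset two_poset true).
  + exact (mono_id two_poset).
- intros []; reflexivity.
- intros x y z; destruct x, y, z; simpl; intros [] []; apply mono_eq; reflexivity.
- intros x y u v H; simpl in H; rewrite H; intros w; apply ple_refl.
Defined.

Lemma comma_weight_finite : finite_weight comma_weight.
Proof.
split; [|split].
- exists (cs_left :: cs_right :: cs_apex :: nil)%list; intros []; simpl; auto.
- intros [] []; first [exists (tt :: nil)%list; intros []; left; reflexivity
                      | exists nil; intros []].
- intros []; first [exists (tt :: nil)%list; intros []; left; reflexivity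
                   | exists (true :: false :: nil)%list; intros []; simpl; auto].
Qed.

Lemma comma_exists (C : concretely_order_regular) (A B K : C) (f : hom A K) (g : hom B K) :
  exists (W : C) (p : hom W A) (q : hom W B),
    f ∘ p ⪯ g ∘ q /\
    (forall x y, app f x ⊑ app g y -> exists w, app p w = x /\ app q w = y) /\
    (forall w w' : under W, app p w ⊑ app p w' -> app q w ⊑ app q w' -> w ⊑ w').
Proof.
destruct (or_limits (cospan_functor f g) comma_weight_finite) as [W [lam Hlam]].
pose proof (forget_limits comma_weight_finite Hlam) as HU.
pose (p := leg lam cs_left tt); pose (q := leg lam cs_right tt).
pose proof (@leg_natural _ _ _ _ _ lam cs_left cs_apex tt tt) as Ep; simpl in Ep.
pose proof (@leg_natural _ _ _ _ _ lam cs_right cs_apex tt tt) as Eq; simpl in Eq.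
exists W, p, q; split; [|split].
- unfold p, q; rewrite Ep, Eq.
  refine (@leg_mono _ _ _ _ _ lam cs_apex false true _); discriminate.
- intros x y Hxy.
  unshelve epose (mu := @WeightedCone Pos _ comma_weight
    (comp_posfunctor forget (cospan_functor f g)) one_poset
    (fun d => match d return (comma_weight d : poset) ->
        @hom Pos one_poset (comp_posfunctor forget (cospan_functor f g) d) with
      | cs_left => fun _ => @mono_const one_poset (under A) x
      | cs_right => fun _ => @mono_const one_poset (under B) y
      | cs_apex => fun b => @mono_const one_poset (under K)
                     (if b : bool then app g y else app f x)
      end) _ _).
  + intros [] i j Hij z; try apply ple_refl.
    destruct i, j; simpl; try apply ple_refl; [|exact Hxy].
    discriminate (Hij eq_refl).
  + intros d d' u i; apply mono_eq; intros z.
    destruct d, d'; destruct u; simpl; try reflexivity.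
    all: exact (app_id _).
  + destruct (proj1 (HU one_poset) mu) as [h Hh].
    exists ((h : mono one_poset (under W)) tt); split.
    * exact (f_equal (fun k : mono one_poset (under A) => k tt) (Hh cs_left tt)).
    * exact (f_equal (fun k : mono one_poset (under B) => k tt) (Hh cs_right tt)).
- intros w w' H1 H2.
  refine (proj2 (HU one_poset) (@mono_const one_poset (under W) w)
    (@mono_const one_poset (under W) w') _ tt).
  intros [] i x.
  + destruct i; exact H1.
  + destruct i; exact H2.
  + change (app (leg lam cs_apex i) w ⊑ app (leg lam cs_apex i) w').
    destruct i.
    * rewrite <- Eq; unfold q in H2; rewrite !app_comp; apply mfun_mono, H2.
    * rewrite <- Ep; unfold p in H1; rewrite !app_comp; apply mfun_mono, H1.
Qed.

Lemma tabulates_intro (C : concretely_order_regular) (A B W : C) (p : hom W A) (q : hom W B)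
    (R : wrel (under A) (under B)) :
  (forall w w' : under W, app p w ⊑ app p w' -> app q w ⊑ app q w' -> w ⊑ w') ->
  (forall w, R (app p w) (app q w)) ->
  (forall a b, R a b -> exists w, app p w = a /\ app q w = b) ->
  tabulates p q R.
Proof.
intros He Hi Hs.
unshelve epose (i := @Mono (under W) (graph R)
  (fun w => exist _ (app p w, app q w) (Hi w)) _).
{ intros w w' H; split; apply mfun_mono; exact H. }
pose (c := fun z : graph R => constructive_indefinite_description _
  (Hs (fst (proj1_sig z)) (snd (proj1_sig z)) (proj2_sig z))).
assert (Hc : forall z, app p (proj1_sig (c z)) = fst (proj1_sig z) /\
                       app q (proj1_sig (c z)) = snd (proj1_sig z)).
{ intros z; exact (proj2_sig (c z)). }
unshelve epose (j := @Mono (graph R) (under W) (fun z => proj1_sig (c z)) _).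
{ intros z z' [H1 H2]; destruct (Hc z) as [E1 E2], (Hc z') as [E3 E4].
  apply He; [rewrite E1, E3 | rewrite E2, E4]; assumption. }
unshelve eexists (@PosetIso (under W) (graph R) i j _ _).
- intros z; destruct (Hc z) as [E1 E2]; apply ple_antisym; split; simpl;
    rewrite ?E1, ?E2; apply ple_refl.
- intros w; destruct (Hc (i w)) as [E1 E2]; simpl in E1, E2.
  apply ple_antisym; apply He; simpl; rewrite ?E1, ?E2; apply ple_refl.
- split; intros w; reflexivity.
Qed.

Lemma tabulates_elim (C : concretely_order_regular) (A B W : C) (p : hom W A) (q : hom W B)
    (R : wrel (under A) (under B)) :
  tabulates p q R ->
  (forall w, R (app p w) (app q w)) /\
  (forall a b, R a b -> exists w, app p w = a /\ app q w = b).
Proof.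
intros [i [H1 H2]]; split.
- intros w; rewrite <- H1, <- H2; exact (proj2_sig (i w)).
- intros a b H; pose (z := exist (fun ab => R (fst ab) (snd ab)) (a, b) H : graph R).
  exists (iso_from i z); rewrite <- H1, <- H2, (iso_to_from i); split; reflexivity.
Qed.

Lemma comma_tabulated (C : concretely_order_regular) (A B K : C) (f : hom A K) (g : hom B K)
    (R : wrel (under A) (under B)) :
  (forall a b, R a b <-> app f a ⊑ app g b) ->
  exists (W : C) (p : hom W A) (q : hom W B), tabulates p q R.
Proof.
intros HR; destruct (comma_exists f g) as [W [p [q [Hle [Hs He]]]]].
exists W, p, q; apply tabulates_intro.
- exact He.
- intros w; apply HR; rewrite <- !app_comp; apply app_le, Hle.
- intros a b Hab; apply Hs, HR, Hab.
Qed.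

Lemma span_tabulated (C : concretely_order_regular) (A B V : C) (p : hom V A) (q : hom V B)
    (R : wrel (under A) (under B)) :
  (forall a b, R a b <-> exists v, app p v = a /\ app q v = b) ->
  exists (W : C) (p' : hom W A) (q' : hom W B), tabulates p' q' R.
Proof.
intros HR; destruct (product_exists A B) as [K [k1 [k2 [Hk He]]]].
destruct (Hk V p q) as [h [E1 E2]].
destruct (fs_factor (or_factorisation C) h) as [W [e [m [HE [HM E]]]]].
apply or_E_surjection in HE; apply or_M_embedding in HM.
assert (F1 : forall v, app (k1 ∘ m) (app e v) = app p v).
{ intros v; rewrite <- E1, <- E, <- app_comp, comp_assoc; reflexivity. }
assert (F2 : forall v, app (k2 ∘ m) (app e v) = app q v).
{ intros v; rewrite <- E2, <- E, <- app_comp, comp_assoc; reflexivity. }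
exists W, (k1 ∘ m), (k2 ∘ m); apply tabulates_intro.
- intros w w'; rewrite !app_comp; intros H1 H2; apply HM; exact (He _ _ H1 H2).
- intros w; destruct (HE w) as [v <-]; apply HR; exists v.
  split; symmetry; [apply F1 | apply F2].
- intros a b H; apply HR in H; destruct H as [v [<- <-]]; exists (app e v).
  split; [apply F1 | apply F2].
Qed.

Definition crel_id (C : concretely_order_regular) (A : C) : crel A A.
Proof.
exists (wrel_id (under A)); apply (comma_tabulated (f := ident A) (g := ident A)).
intros a b; rewrite !app_id; reflexivity.
Defined.

Definition crel_lower (C : concretely_order_regular) (A B : C) (f : hom A B) : crel A B.
Proof.
exists (lower_star (app f)); apply (comma_tabulated (f := f) (g := ident B)).
intros a b; rewrite app_id; reflexivity.
Defined.

Definition crel_upper (C : concretely_order_regular) (A B : C) (f : hom A B) : crel B A.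
Proof.
exists (upper_star (app f)); apply (comma_tabulated (f := ident B) (g := f)).
intros a b; rewrite app_id; reflexivity.
Defined.

Definition crel_comp (C : concretely_order_regular) (A B K : C)
    (S : crel B K) (R : crel A B) : crel A K.
Proof.
exists (cr S · cr R).
destruct (cr_tabulated R) as [W [p [q HR]]], (cr_tabulated S) as [W' [p' [q' HS]]].
apply tabulates_elim in HR; apply tabulates_elim in HS.
destruct HR as [HR1 HR2], HS as [HS1 HS2].
destruct (comma_exists q p') as [V [r [s [Hle [Hs _]]]]].
apply (span_tabulated (p := p ∘ r) (q := q' ∘ s)).
intros a c; split.
- intros [b [H1 H2]].
  destruct (HR2 _ _ H1) as [w [<- <-]], (HS2 _ _ H2) as [w' [E <-]].
  destruct (Hs w w') as [v [<- <-]]; [rewrite E; apply ple_refl|].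
  exists v; rewrite !app_comp; split; reflexivity.
- intros [v [<- <-]]; exists (app q (app r v)); rewrite !app_comp; split.
  + apply HR1.
  + refine (wr_weaken _ (HS1 (app s v)) (ple_refl _)).
    rewrite <- !app_comp; apply app_le, Hle.
Defined.

Definition SS_data (C : concretely_order_regular) : double_data.
Proof.
refine (@DoubleData C (fun A B => crel A B)
  (fun A B A' B' f g S R => forall a b, S a b -> R (app f a) (app g b))
  _ _ (fun A => crel_id A) _ (fun A B K R S => crel_comp S R) _ _ _ _ _ _ _).
- intros A B M a b H; rewrite !app_id; exact H.
- intros A B A1 B1 A2 B2 f g f' g' M N K H1 H2 a b H; rewrite !app_comp.
  apply H1, H2, H.
- intros A B f a b H; exact (mfun_mono (app f) H).
- intros A B K A' B' K' f g h M N M' N' H1 H2 a c [b [Ha Hb]]; exists (app g b); auto.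
- intros A B K L M N P a d [c [[b [H1 H2]] H3]]; rewrite !app_id.
  exists b; split; [exact H1 | exists c; auto].
- intros A B K L M N P a d [b [H1 [c [H2 H3]]]]; rewrite !app_id.
  exists c; split; [exists b; auto | exact H3].
- intros A B M a b [a' [H1 H2]]; rewrite !app_id; exact (wr_weaken H1 H2 (ple_refl b)).
- intros A B M a b H; rewrite !app_id; exists a; split; [apply ple_refl | exact H].
- intros A B M a b [b' [H1 H2]]; rewrite !app_id; exact (wr_weaken (ple_refl a) H1 H2).
- intros A B M a b H; rewrite !app_id; exists b; split; [exact H | apply ple_refl].
Defined.

Lemma SS_cell_unique (C : concretely_order_regular) (A B A' B' : SS_data C)
    (M : hor A B) (N : hor A' B') (f : hom A A') (g : hom B B') (a b : cell f g M N) :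
  a = b.
Proof.
exact (proof_irrelevance (forall x y, cr M x y -> cr N (app f x) (app g y)) a b).
Qed.

Lemma SS_cell_eq (C : concretely_order_regular) (A B A' B' : SS_data C)
    (M : hor A B) (N : hor A' B')
    (f f' : hom A A') (g g' : hom B B') (a : cell f g M N) (b : cell f' g' M N) :
  f = f' -> g = g' -> a ≈ b.
Proof.
intros; subst f' g'; unfold cell_eq; f_equal; apply SS_cell_unique.
Qed.

Lemma SS_laws (C : concretely_order_regular) : double_laws (SS_data C).
Proof.
split; intros; apply SS_cell_eq; simpl;
  rewrite ?comp_id_l, ?comp_id_r, ?comp_assoc; reflexivity.
Qed.

Lemma SS_cartesian (C : concretely_order_regular) (A B A' B' : SS_data C)
    (f : hom A A') (g : hom B B') (N : hor A' B') :
  exists (M : hor A B) (a : cell f g M N), cartesian a.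
Proof.
exists (crel_comp (crel_upper g) (crel_comp N (crel_lower f))).
unshelve eexists.
- intros a b [b' [[a' [H1 H2]] H3]]; exact (wr_weaken H1 H2 H3).
- intros P Q h k K c; unshelve eexists.
  + intros x y H; specialize (c x y H); rewrite !app_comp in c.
    exists (app g (app k y)); split; [|apply ple_refl].
    exists (app f (app h x)); split; [apply ple_refl | exact c].
  + split; [apply SS_cell_unique | intros; apply SS_cell_unique].
Qed.

Lemma SS_opcartesian (C : concretely_order_regular) (A B A' B' : SS_data C)
    (f : hom A A') (g : hom B B') (M : hor A B) :
  exists (N : hor A' B') (a : cell f g M N), opcartesian a.
Proof.
exists (crel_comp (crel_lower g) (crel_comp M (crel_upper f))).
unshelve eexists.
- intros a b H; exists b; split; [|apply ple_refl].
  exists a; split; [apply ple_refl | exact H].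
- intros P Q h k K c; unshelve eexists.
  + intros x y [b [[a [H1 H2]] H3]]; specialize (c a b H2); rewrite !app_comp in c.
    exact (wr_weaken (mfun_mono (app h) H1) c (mfun_mono (app k) H3)).
  + split; [apply SS_cell_unique | intros; apply SS_cell_unique].
Qed.

Definition SS (C : concretely_order_regular) : framed_bicategory :=
  @FramedBicategory (SS_data C) (SS_laws C) (@SS_cartesian C) (@SS_opcartesian C).

Definition preserves_exact_squares (C D : concretely_order_regular) (F : functor C (op D)) : Prop :=
  forall (W A1 A2 K : C) (p : hom W A1) (q : hom W A2) (f : hom A1 K) (g : hom A2 K),
    exact_square p q f g ->
    let Fp : @hom D (F A1) (F W) := fmap F p in
    let Fq : @hom D (F A2) (F W) := fmap F q in
    let Ff : @hom D (F K) (F A1) := fmap F f in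
    let Fg : @hom D (F K) (F A2) := fmap F g in
    wrel_eq (upper_star (app Fq) · lower_star (app Fp))
            (lower_star (app Fg) · upper_star (app Ff)).

Definition maps_surjections_to_embeddings (C D : concretely_order_regular) (F : functor C (op D)) :
  Prop :=
  forall (A B : C) (e : hom A B),
    Surjective (app e) -> order_embedding (app (fmap F e : @hom D (F B) (F A))).

Definition acts_by_tabulation (C D : concretely_order_regular) (F : functor C (op D))
    (SF : forall A B : C, crel A B -> @crel D (F A) (F B)) : Prop :=
  forall (A B W : C) (R : crel A B) (p : hom W A) (q : hom W B),
    tabulates p q R ->
    forall (a : @under D (F A)) (b : @under D (F B)),
      SF A B R a b <->
      app (fmap F p : @hom D (F A) (F W)) a ⊑ app (fmap F q : @hom D (F B) (F W)) b.

(* Main.v *)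
From Stdlib Require Import FinFun IndefiniteDescription.
Require Import Defs.

(** If the image of a span is contained in that of another one, the pullback of the two
    over the product covers the first apex; as [F] sends covers to embeddings, the relation
    [Fp x ⊑ Fq y] depends only on the image of the span [(p, q)] and is antitone in it. Since
    [F] preserves comma squares, this action preserves units and composites. The relation
    [SF M] is itself spanned by the comma of [Fp] and [Fq], so exactness of [G] shows that
    [SG (SF M) x y] holds iff [x ⊑ GFp z] and [GFq z ⊑ y] for some [z : GFW]. Naturality of
    the unit then makes it a cell, and its inverse too when there is one. Cells being unique,
    all remaining equations are equations between vertical arrows. *)

Set Implicit Arguments.
Unset Strict Implicit.

(** * Double categories with at most one cell in each frame *)

Definition thin (D : double_data) : Prop :=
  forall (A B A' B' : D) (f : hom A A') (g : hom B B') (M : hor A B) (N : hor A' B')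
    (a b : cell f g M N), a = b.

Lemma thin_cell_eq (D : double_data) (A B A' B' : D) (M : hor A B) (N : hor A' B')
    (f f' : hom A A') (g g' : hom B B') (a : cell f g M N) (b : cell f' g' M N) :
  thin D -> f = f' -> g = g' -> a ≈ b.
Proof. intros HD; intros; subst f' g'; unfold cell_eq; f_equal; apply HD. Qed.

Lemma thin_SS (C : concretely_order_regular) : thin (SS C).
Proof. intros A B A' B' f g M N a b; apply SS_cell_unique. Qed.

Lemma thin_coop (D : framed_bicategory) : thin D -> thin (coop D).
Proof. intros HD A B A' B' f g M N a b; exact (HD A' B' A B f g N M a b). Qed.

Section ThinFunctor.

Variables (D E : framed_bicategory) (HE : thin E) (F : functor D E).
Variable hor_map : forall A B : D, hor A B -> hor (F A) (F B).
Hypothesis cell_map : forall (A B A' B' : D) (f : hom A A') (g : hom B B')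
  (M : hor A B) (N : hor A' B'),
  cell f g M N -> cell (fmap F f) (fmap F g) (hor_map M) (hor_map N).
Hypothesis comp_map : forall (A B C : D) (M : hor A B) (N : hor B C),
  cell (ident (F A)) (ident (F C)) (hor_map M ⊙ hor_map N) (hor_map (M ⊙ N)).
Hypothesis comp_map_inv : forall (A B C : D) (M : hor A B) (N : hor B C),
  cell (ident (F A)) (ident (F C)) (hor_map (M ⊙ N)) (hor_map M ⊙ hor_map N).
Hypothesis unit_map : forall A : D,
  cell (ident (F A)) (ident (F A)) (hunit (F A)) (hor_map (hunit A)).
Hypothesis unit_map_inv : forall A : D,
  cell (ident (F A)) (ident (F A)) (hor_map (hunit A)) (hunit (F A)).

(** Each coherence law compares two cells over vertical arrows that agree by functoriality of [F],
    so thinness of [E] settles them all. *)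
Definition thin_framed_functor : framed_functor F.
Proof.
refine (@FramedFunctor D E F hor_map cell_map comp_map comp_map_inv unit_map unit_map_inv
  _ _ _ _ _ _ _ _ _ _ _);
  intros; apply (thin_cell_eq _ _ HE);
  rewrite ?fmap_id, ?fmap_comp, ?comp_id_l, ?comp_id_r; reflexivity.
Defined.

End ThinFunctor.

Definition thin_framed_trans (D E : framed_bicategory) (HE : thin E) (F G : functor D E)
    (S : framed_functor F) (T : framed_functor G) (t : nat_trans F G)
    (c : forall (A B : D) (M : hor A B), cell (t A) (t B) (ff_hor S M) (ff_hor T M)) :
  framed_trans S T.
Proof.
refine (@FramedTrans D E F G S T t c _ _ _); intros; apply (thin_cell_eq _ _ HE);
  rewrite ?comp_id_l, ?comp_id_r; first [apply nt_natural | reflexivity].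
Defined.

Definition thin_framed_adjunction (D E : framed_bicategory) (HD : thin D) (HE : thin E)
    (F : functor D E) (G : functor E D) (S : framed_functor F) (T : framed_functor G)
    (adj : adjunction F G)
    (u : forall (A B : D) (M : hor A B),
       cell (adj_unit adj A) (adj_unit adj B) M (ff_hor T (ff_hor S M)))
    (c : forall (A B : E) (M : hor A B),
       cell (adj_counit adj A) (adj_counit adj B) (ff_hor S (ff_hor T M)) M) :
  framed_adjunction S T.
Proof.
refine (@FramedAdjunction D E F G S T
  (@thin_framed_trans D D HD _ _ (id_framed_functor D) (comp_framed_functor T S)
     (adj_unit adj) u)
  (@thin_framed_trans E E HE _ _ (comp_framed_functor S T) (id_framed_functor E)
     (adj_counit adj) c)
  (adj_triangle_l adj) _ (adj_triangle_r adj) _); intros;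
  [apply (thin_cell_eq _ _ HE) | apply (thin_cell_eq _ _ HD)]; simpl;
  first [apply (adj_triangle_l adj) | apply (adj_triangle_r adj)].
Defined.

(** * Inverses of natural and framed transformations *)

Lemma nat_trans_inverse (C D : category) (F G : functor C D) (t : nat_trans F G) :
  (forall A, is_iso (t A)) ->
  exists s : nat_trans G F, forall A, s A ∘ t A = ident (F A) /\ t A ∘ s A = ident (G A).
Proof.
intros H.
(* Each inverse is only known to exist; choice gathers them into a family. *)
assert (Hs : exists s : forall A, hom (G A) (F A),
  forall A, s A ∘ t A = ident (F A) /\ t A ∘ s A = ident (G A)).
{ exists (fun A => proj1_sig (constructive_indefinite_description _ (H A))).
  intros A; exact (proj2_sig (constructive_indefinite_description _ (H A))). }
destruct Hs as [s Hs].
unshelve eexists (@NatTrans C D G F s _); [|exact Hs].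
intros A B f.
(* Insert [t A ∘ s A] on the right, move [t] across by its naturality, and cancel it against
   [s B]. *)
rewrite <- (comp_id_r (s B ∘ fmap G f)), <- (proj2 (Hs A)).
rewrite comp_assoc, <- (comp_assoc (t A)), <- nt_natural.
rewrite comp_assoc, (proj1 (Hs B)), comp_id_l; reflexivity.
Qed.

Lemma thin_framed_trans_invertible (D E : framed_bicategory) (HE : thin E)
    (F G : functor D E) (S : framed_functor F) (T : framed_functor G)
    (a : framed_trans S T) (s : nat_trans G F) :
  (forall A, s A ∘ a A = ident (F A) /\ a A ∘ s A = ident (G A)) ->
  (forall (A B : D) (M : hor A B), cell (s A) (s B) (ff_hor T M) (ff_hor S M)) ->
  framed_trans_invertible a.
Proof.
intros H c; exists (thin_framed_trans HE c); split; [exact H|].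
intros A B M; split; apply (thin_cell_eq _ _ HE); apply H.
Qed.

(** * Pullbacks and covers of spans *)

Definition conical_weight : posfunctor (discrete_poscat cospan_category) Pos.
Proof.
unshelve refine (@PosFunctor (discrete_poscat cospan_category) Pos
  (@Functor cospan_category Pos (fun x => one_poset) (fun x y e => mono_id one_poset) _ _) _).
- intros x; reflexivity.
- intros x y z f g; apply mono_eq; reflexivity.
- intros x y f g H z; apply ple_refl.
Defined.

Lemma conical_weight_finite : finite_weight conical_weight.
Proof.
destruct comma_weight_finite as [H1 [H2 _]]; split; [exact H1 | split; [exact H2|]].
intros d; exists (tt :: nil)%list; intros []; left; reflexivity.
Qed.

(** With the one-point weight the limit of a cospan is a strict pullback; since [forget] preserves
    it, its elements can be found in posets. *)
Lemma pullback_exists (C : concretely_order_regular) (A B K : C) (f : hom A K) (g : hom B K) :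
  exists (W : C) (p : hom W A) (q : hom W B),
    f ∘ p = g ∘ q /\
    (forall x y, app f x = app g y -> exists w, app p w = x /\ app q w = y).
Proof.
destruct (or_limits (cospan_functor f g) conical_weight_finite) as [W [lam Hlam]].
pose proof (forget_limits conical_weight_finite Hlam) as HU.
pose proof (@leg_natural _ _ _ _ _ lam cs_left cs_apex tt tt) as Ep; simpl in Ep.
pose proof (@leg_natural _ _ _ _ _ lam cs_right cs_apex tt tt) as Eq; simpl in Eq.
exists W, (leg lam cs_left tt), (leg lam cs_right tt); split.
- rewrite Ep, Eq; reflexivity.
- intros x y Hxy.
  (* The pair [(x, y)] is a cone with vertex the one-point poset; the mediating map picks out the
     element [w]. *)
  unshelve epose (mu := @WeightedCone Pos _ conical_weight
    (comp_posfunctor forget (cospan_functor f g)) one_poset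
    (fun d _ => match d return
        @hom Pos one_poset (comp_posfunctor forget (cospan_functor f g) d) with
      | cs_left => @mono_const one_poset (under A) x
      | cs_right => @mono_const one_poset (under B) y
      | cs_apex => @mono_const one_poset (under K) (app f x)
      end) _ _).
  + intros d i j _ z; apply ple_refl.
  + intros d d' u i; apply mono_eq; intros z.
    destruct d, d'; destruct u; simpl; try reflexivity.
    all: first [exact (app_id _) | exact (eq_sym Hxy)].
  + destruct (proj1 (HU one_poset) mu) as [h Hh].
    exists ((h : mono one_poset (under W)) tt); split.
    * exact (f_equal (fun k : mono one_poset (under A) => k tt) (Hh cs_left tt)).
    * exact (f_equal (fun k : mono one_poset (under B) => k tt) (Hh cs_right tt)).
Qed.

(** Pull back the two pairings into the product of [A] and [B]: the leg to [W] is onto because every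
    [w] has a partner in [W'] with the same image. *)
Lemma span_cover (C : concretely_order_regular) (A B W W' : C)
    (p : hom W A) (q : hom W B) (p' : hom W' A) (q' : hom W' B) :
  (forall w, exists w', app p' w' = app p w /\ app q' w' = app q w) ->
  exists (V : C) (r : hom V W) (s : hom V W'),
    Surjective (app r) /\ p ∘ r = p' ∘ s /\ q ∘ r = q' ∘ s.
Proof.
intros H; destruct (product_exists A B) as [K [k1 [k2 [Hk He]]]].
destruct (Hk W p q) as [h [<- <-]], (Hk W' p' q') as [h' [<- <-]].
destruct (pullback_exists h h') as [V [r [s [E Hs]]]].
exists V, r, s; split; [|rewrite <- !comp_assoc, E; split; reflexivity].
intros w; destruct (H w) as [w' [E1 E2]]; rewrite !app_comp in E1, E2.
destruct (Hs w w') as [v [Ev _]]; [|exists v; exact Ev].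
(* The product projections jointly reflect the order, so equal coordinates give [h w = h' w']. *)
apply ple_antisym; apply He; rewrite ?E1, ?E2; apply ple_refl.
Qed.

Lemma comma_exact (C : concretely_order_regular) (A B K W : C)
    (f : hom A K) (g : hom B K) (p : hom W A) (q : hom W B) :
  f ∘ p ⪯ g ∘ q ->
  (forall x y, app f x ⊑ app g y -> exists w, app p w = x /\ app q w = y) ->
  exact_square p q f g.
Proof.
intros H1 H2; split; [exact H1|].
intros x y H; destruct (H2 x y H) as [w [<- <-]]; exists w; split; apply ple_refl.
Qed.

(** * The action of a contravariant functor on relations *)

Section Contravariant.

Variables (C D : concretely_order_regular) (F : functor C (op D)).
Hypothesis F_exact : preserves_exact_squares F.
Hypothesis F_surj : maps_surjections_to_embeddings F.

Definition fapp (A B : C) (f : hom A B) : mono (@under D (F B)) (@under D (F A)) :=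
  app (fmap F f : @hom D (F B) (F A)).

Lemma fapp_comp (A B K : C) (f : hom A B) (g : hom B K) (x : @under D (F K)) :
  fapp (g ∘ f) x = fapp f (fapp g x).
Proof. unfold fapp; rewrite (fmap_comp F); exact (app_comp _ _ _). Qed.

Lemma fapp_id (A : C) (x : @under D (F A)) : fapp (ident A) x = x.
Proof. unfold fapp; rewrite (fmap_id F); exact (app_id _). Qed.

(** Preservation of exact squares, read at elements: on the side of [p] and [q] the intermediate
    element can be taken to be [fapp p x], or removed by transitivity. *)
Lemma fapp_exact (W A1 A2 K : C) (p : hom W A1) (q : hom W A2) (f : hom A1 K) (g : hom A2 K)
    (x : @under D (F A1)) (y : @under D (F A2)) :
  exact_square p q f g ->
  (fapp p x ⊑ fapp q y <-> exists z, x ⊑ fapp f z /\ fapp g z ⊑ y).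
Proof.
intros H; destruct (F_exact H x y) as [H1 H2]; split.
- intros Hxy; apply H1; exists (fapp p x); split; [apply ple_refl | exact Hxy].
- intros Hz; destruct (H2 Hz) as [w [Hw1 Hw2]]; exact (ple_trans Hw1 Hw2).
Qed.

(** Here [(p, q)] fills an exact square over two identities, whose image under [F] interpolates some
    [z] between [x] and [y]. This gives preservation of units. *)
Lemma fapp_comma_ident (A W : C) (p q : hom W A) (x y : @under D (F A)) :
  p ⪯ q -> (forall a b, a ⊑ b -> exists w, app p w = a /\ app q w = b) ->
  (fapp p x ⊑ fapp q y <-> x ⊑ y).
Proof.
intros H1 H2; rewrite (@fapp_exact _ _ _ _ p q (ident A) (ident A)).
- split.
  + intros [z [Hx Hy]]; rewrite fapp_id in Hx, Hy; exact (ple_trans Hx Hy).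
  + intros H; exists x; rewrite fapp_id; split; [apply ple_refl | exact H].
- apply comma_exact; [rewrite !comp_id_l; exact H1|].
  intros a b; rewrite !app_id; apply H2.
Qed.

Lemma span_contravariant (A B W W' : C)
    (p : hom W A) (q : hom W B) (p' : hom W' A) (q' : hom W' B)
    (x : @under D (F A)) (y : @under D (F B)) :
  (forall w, exists w', app p' w' = app p w /\ app q' w' = app q w) ->
  fapp p' x ⊑ fapp q' y -> fapp p x ⊑ fapp q y.
Proof.
intros H Hxy; destruct (span_cover H) as [V [r [s [Hr [E1 E2]]]]].
(* The embedding [fapp r] reflects the order, and after [r] the first span becomes the second one
   composed with [s]. *)
apply (F_surj Hr); fold (fapp r); rewrite <- !fapp_comp, E1, E2, !fapp_comp.
apply mfun_mono, Hxy.
Qed.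

(** One tabulation of [R] defines the value, which the comma of [Fp] and [Fq] tabulates. Any other
    tabulation has the same image, so antitonicity in both directions gives the same relation. *)
Lemma tabulation_action_exists :
  exists SF : forall A B : C, crel A B -> @crel D (F A) (F B), acts_by_tabulation SF.
Proof.
assert (H : forall (A B : C) (R : crel A B), exists S : @crel D (F A) (F B),
  forall (W : C) (p : hom W A) (q : hom W B), tabulates p q R ->
  forall a b, S a b <-> fapp p a ⊑ fapp q b).
{ intros A B R; destruct (cr_tabulated R) as [W [p [q HR]]].
  pose (S := @WRel _ _ (fun a b => fapp p a ⊑ fapp q b)
    (fun a' a b b' H1 H2 H3 =>
       ple_trans (mfun_mono (fapp p) H1) (ple_trans H2 (mfun_mono (fapp q) H3)))).
  unshelve eexists (@CRel D (F A) (F B) S _).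
  - apply (comma_tabulated (f := fmap F p : @hom D (F A) (F W))
      (g := fmap F q : @hom D (F B) (F W))); intros a b; reflexivity.
  - intros W' p' q' HR' a b; apply tabulates_elim in HR, HR'.
    destruct HR as [H1 H2], HR' as [H1' H2'].
    split; apply span_contravariant; intros w; auto. }
exists (fun A B R => proj1_sig (constructive_indefinite_description _ (H A B R))).
intros A B W R p q HR; destruct (constructive_indefinite_description _ (H A B R)) as [S HS].
exact (HS W p q HR).
Qed.

Variable SF : forall A B : C, crel A B -> @crel D (F A) (F B).
Hypothesis HSF : acts_by_tabulation SF.

(** Frees the computation from jointly order-reflecting spans: a composite of relations comes with a
    span having the right image, which need not be a tabulation. *)
Lemma action_by_span (A B W : C) (R : crel A B) (p : hom W A) (q : hom W B)
    (x : @under D (F A)) (y : @under D (F B)) :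
  (forall a b, R a b <-> exists w, app p w = a /\ app q w = b) ->
  (SF R x y <-> fapp p x ⊑ fapp q y).
Proof.
intros HR; destruct (cr_tabulated R) as [W' [p' [q' HR']]].
rewrite (HSF HR'); apply tabulates_elim in HR'; destruct HR' as [H1 H2].
split; apply span_contravariant; intros w.
- apply H2, HR; exists w; split; reflexivity.
- apply HR, H1.
Qed.

(** The tabulation of [M] followed by [f] and [g] has its image inside that of [N]; antitonicity
    reverses the inclusion. *)
Lemma action_cell (A B A' B' : C) (f : hom A A') (g : hom B B')
    (M : crel A B) (N : crel A' B') :
  (forall a b, M a b -> N (app f a) (app g b)) ->
  forall x y, SF N x y -> SF M (fapp f x) (fapp g y).
Proof.
intros H x y.
destruct (cr_tabulated M) as [W [p [q HM]]], (cr_tabulated N) as [W' [p' [q' HN]]].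
rewrite (HSF HM), (HSF HN); apply tabulates_elim in HM, HN.
fold (fapp p) (fapp q) (fapp p') (fapp q'); rewrite <- !fapp_comp.
apply span_contravariant; intros w; rewrite !app_comp.
apply (proj2 HN), H, HM.
Qed.

Lemma action_unit (A : C) (x y : @under D (F A)) : SF (crel_id A) x y <-> x ⊑ y.
Proof.
destruct (comma_exists (ident A) (ident A)) as [W [p [q [H1 [H2 _]]]]].
rewrite !comp_id_l in H1.
assert (H2' : forall a b, a ⊑ b -> exists w, app p w = a /\ app q w = b).
{ intros a b Hab; apply H2; rewrite !app_id; exact Hab. }
rewrite (@action_by_span _ _ W (crel_id A) p q), fapp_comma_ident; auto; [reflexivity|].
intros a b; split; [apply H2'|].
intros [w [<- <-]]; apply app_le, H1.
Qed.

(* The comma square over the middle object spans the composite relation, and its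
   preservation by [F] is the Beck-Chevalley condition splitting the image. *)
Lemma action_comp (A B K : C) (M : crel A B) (N : crel B K)
    (x : @under D (F A)) (y : @under D (F K)) :
  SF (crel_comp N M) x y <-> exists z, SF M x z /\ SF N z y.
Proof.
destruct (cr_tabulated M) as [W [p [q HM]]], (cr_tabulated N) as [W' [p' [q' HN]]].
destruct (comma_exists q p') as [V [r [s [Hle [Hs _]]]]].
assert (E : forall a c, crel_comp N M a c <->
  exists v, app (p ∘ r) v = a /\ app (q' ∘ s) v = c).
{ apply tabulates_elim in HM, HN; destruct HM as [HM1 HM2], HN as [HN1 HN2].
  intros a c; split.
  - intros [b [H1 H2]].
    destruct (HM2 _ _ H1) as [w [<- <-]], (HN2 _ _ H2) as [w' [E <-]].
    destruct (Hs w w') as [v [<- <-]]; [rewrite E; apply ple_refl|].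
    exists v; rewrite !app_comp; split; reflexivity.
  - intros [v [<- <-]]; exists (app q (app r v)); rewrite !app_comp; split.
    + apply HM1.
    + refine (wr_weaken _ (HN1 (app s v)) (ple_refl _)).
      rewrite <- !app_comp; apply app_le, Hle. }
rewrite (action_by_span x y E), !fapp_comp, (fapp_exact _ _ (comma_exact Hle Hs)).
split; intros [z Hz]; exists z; rewrite (HSF HM), (HSF HN) in *; exact Hz.
Qed.

End Contravariant.

(** * Units, counits and their inverses as cells *)

Section Unit.

Variables (C D : concretely_order_regular) (F : functor C (op D)) (G : functor D (op C)).
Hypothesis G_exact : preserves_exact_squares G.
Variables (SF : forall A B : C, crel A B -> @crel D (F A) (F B))
  (SG : forall A B : D, crel A B -> @crel C (G A) (G B)).
Hypotheses (HSF : acts_by_tabulation SF) (HSG : acts_by_tabulation SG).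
(** A bare family, natural on elements, so as to cover the counit too: read in the base category
    instead of its opposite, the counit is such a family with [F] and [G] exchanged. *)
Variable eta : forall A : C, @hom C A (G (F A)).
Hypothesis eta_natural : forall (A B : C) (f : hom A B) (a : under A),
  app (eta B) (app f a) = fapp G (fmap F f : @hom D (F B) (F A)) (app (eta A) a).

Lemma double_action (A B W : C) (M : crel A B) (p : hom W A) (q : hom W B)
    (x : @under C (G (F A))) (y : @under C (G (F B))) :
  tabulates p q M ->
  (SG (SF M) x y <->
   exists z : @under C (G (F W)),
     x ⊑ fapp G (fmap F p : @hom D (F A) (F W)) z /\
     fapp G (fmap F q : @hom D (F B) (F W)) z ⊑ y).
Proof.
intros HM.
destruct (comma_exists (fmap F p : @hom D (F A) (F W)) (fmap F q : @hom D (F B) (F W)))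
  as [V [r [s [Hle [Hs He]]]]].
rewrite <- (fapp_exact G_exact x y (comma_exact Hle Hs)).
(* The comma [(r, s)] of [Fp] and [Fq] tabulates [SF M], so its image under [G] computes the
   left-hand side. *)
apply HSG, tabulates_intro; [exact He | |]; intros.
- apply (HSF HM); rewrite <- !app_comp; apply app_le, Hle.
- apply Hs, (HSF HM); assumption.
Qed.

Lemma unit_cell (A B : C) (M : crel A B) (a : under A) (b : under B) :
  M a b -> SG (SF M) (app (eta A) a) (app (eta B) b).
Proof.
intros H; destruct (cr_tabulated M) as [W [p [q HM]]].
apply (double_action _ _ HM); apply tabulates_elim in HM.
(* With [w] over [(a, b)], naturality of [eta] at [p] and [q] makes both inequalities equalities. *)
destruct (proj2 HM a b H) as [w [<- <-]]; exists (app (eta W) w).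
rewrite !eta_natural; split; apply ple_refl.
Qed.

(** As [eta W] is onto, the witness [z] is the image of [w = theta z]. Naturality and [theta] then
    give [theta x ⊑ p w] and [q w ⊑ theta y], and [M] relates [p w] to [q w]. *)
Lemma unit_inverse_cell (theta : forall A : C, @hom C (G (F A)) A) (A B : C) (M : crel A B)
    (x : @under C (G (F A))) (y : @under C (G (F B))) :
  (forall K, theta K ∘ eta K = ident K /\ eta K ∘ theta K = ident (G (F K))) ->
  SG (SF M) x y -> M (app (theta A) x) (app (theta B) y).
Proof.
intros Hi H; destruct (cr_tabulated M) as [W [p [q HM]]].
apply (double_action _ _ HM) in H; apply tabulates_elim in HM.
destruct H as [z [H1 H2]].
assert (Ez : z = app (eta W) (app (theta W) z)).
{ rewrite <- app_comp, (proj2 (Hi W)), app_id; reflexivity. }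
rewrite Ez, <- eta_natural in H1, H2.
assert (Et : forall K (k : under K), app (theta K) (app (eta K) k) = k).
{ intros K k; rewrite <- app_comp, (proj1 (Hi K)); apply app_id. }
apply (mfun_mono (app (theta A))) in H1; apply (mfun_mono (app (theta B))) in H2.
rewrite Et in H1, H2; exact (wr_weaken H1 (proj1 HM _) H2).
Qed.

End Unit.

(** * The two framed functors *)

Section ActionFunctors.

Variables (X A : concretely_order_regular).

Definition action_framed_functor (F : functor X (op A))
    (F_exact : preserves_exact_squares F) (F_surj : maps_surjections_to_embeddings F)
    (SF : forall K L : X, crel K L -> @crel A (F K) (F L)) (HSF : acts_by_tabulation SF) :
  @framed_functor (SS X) (coop (SS A)) F.
Proof.
refine (@thin_framed_functor (SS X) (coop (SS A)) (thin_coop (@thin_SS A)) F SF _ _ _ _ _).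
- intros K L K' L' f g M N; exact (@action_cell _ _ _ F_surj _ HSF _ _ _ _ f g M N).
(* A cell of [coop] is an inclusion read backwards, so the comparison towards the image of a
   composite uses the forward implication of [action_comp]. *)
- intros K L P M N a b H; rewrite !app_id.
  exact (proj1 (action_comp F_exact F_surj HSF M N a b) H).
- intros K L P M N a b H; rewrite !app_id.
  exact (proj2 (action_comp F_exact F_surj HSF M N a b) H).
- intros K a b H; rewrite !app_id; exact (proj1 (action_unit F_exact F_surj HSF a b) H).
- intros K a b H; rewrite !app_id; exact (proj2 (action_unit F_exact F_surj HSF a b) H).
Defined.

Definition coaction_framed_functor (G : functor (op A) X)
    (G_exact : preserves_exact_squares (flip_functor G))
    (G_surj : maps_surjections_to_embeddings (flip_functor G))
    (SG : forall K L : A, crel K L -> @crel X (G K) (G L))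
    (HSG : acts_by_tabulation (F := flip_functor G) SG) :
  @framed_functor (coop (SS A)) (SS X) G.
Proof.
refine (@thin_framed_functor (coop (SS A)) (SS X) (@thin_SS X) G SG _ _ _ _ _).
- intros K L K' L' f g M N; exact (@action_cell _ _ _ G_surj _ HSG _ _ _ _ f g N M).
- intros K L P M N a b H; rewrite !app_id.
  exact (proj2 (action_comp G_exact G_surj HSG M N a b) H).
- intros K L P M N a b H; rewrite !app_id.
  exact (proj1 (action_comp G_exact G_surj HSG M N a b) H).
- intros K a b H; rewrite !app_id; exact (proj2 (action_unit G_exact G_surj HSG a b) H).
- intros K a b H; rewrite !app_id; exact (proj1 (action_unit G_exact G_surj HSG a b) H).
Defined.

End ActionFunctors.

Theorem theorem7p11 (X A : concretely_order_regular)
    (F : functor X (op A)) (G : functor (op A) X) (adj : adjunction F G)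
    (F_exact : preserves_exact_squares F)
    (G_exact : preserves_exact_squares (flip_functor G))
    (F_surj : maps_surjections_to_embeddings F)
    (G_surj : maps_surjections_to_embeddings (flip_functor G)) :
  exists (SF : @framed_functor (SS X) (coop (SS A)) F)
         (SG : @framed_functor (coop (SS A)) (SS X) G),
    acts_by_tabulation (F := F) (fun _ _ R => ff_hor SF R) /\
    acts_by_tabulation (F := flip_functor G) (fun _ _ R => ff_hor SG R) /\
    inhabited (framed_adjunction SF SG) /\
    (equivalence_pair F G -> framed_equivalence_pair SF SG).
Proof.
destruct (tabulation_action_exists F_surj) as [SF HSF].
destruct (tabulation_action_exists G_surj) as [SG HSG].
exists (action_framed_functor F_exact F_surj HSF),
  (coaction_framed_functor G_exact G_surj HSG).
assert (Heta : forall (eta : nat_trans (id_functor X) (comp_functor G F))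
    (K L : X) (f : hom K L) (a : under K),
  app (eta L) (app f a)
  = fapp (flip_functor G) (fmap F f : @hom A (F L) (F K)) (app (eta K) a)).
{ intros eta K L f a; rewrite <- app_comp.
  exact (eq_trans (f_equal (fun h => app h a) (nt_natural eta f)) (app_comp _ _ _)). }
(* An arrow [f] of [A] from [K] to [L] goes from [L] to [K] in [op A], so the naturality square of
   [eps] is read in reverse. *)
assert (Heps : forall (eps : nat_trans (comp_functor F G) (id_functor (op A)))
    (K L : A) (f : hom K L) (a : under K),
  @app A L (F (G L)) (eps L) (app f a)
  = fapp F (fmap (flip_functor G) f : @hom X (G L) (G K)) (@app A K (F (G K)) (eps K) a)).
{ intros eps K L f a; rewrite <- app_comp.
  exact (eq_trans (f_equal (fun h => @app A K (F (G L)) h a)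
    (eq_sym (@nt_natural _ _ _ _ eps L K f))) (@app_comp A _ _ _ _ _ _)). }
pose proof (@thin_SS X) as HX; pose proof (thin_coop (@thin_SS A)) as HA.
assert (U : forall (eta : nat_trans (id_functor X) (comp_functor G F)) (K L : X)
    (M : crel K L) a b, M a b -> SG _ _ (SF _ _ M) (app (eta K) a) (app (eta L) b)).
{ intros eta; exact (unit_cell G_exact HSF HSG (Heta eta)). }
assert (V : forall (eps : nat_trans (comp_functor F G) (id_functor (op A))) (K L : A)
    (M : crel K L) a b, M a b ->
  SF _ _ (SG _ _ M) (@app A K (F (G K)) (eps K) a) (@app A L (F (G L)) (eps L) b)).
{ intros eps; exact (unit_cell F_exact HSG HSF (Heps eps)). }
split; [exact HSF | split; [exact HSG | split]].
- constructor; refine (@thin_framed_adjunction _ _ HX HA F G _ _ adj _ _).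
  + exact (U (adj_unit adj)).
  + exact (V (adj_counit adj)).
(* These [eta] and [eps] may differ from the unit and counit of [adj]; [U] and [V] are stated for
   arbitrary natural transformations. *)
- intros [eta [eps [Ieta Ieps]]].
  exists (@thin_framed_trans _ _ HX _ _ (id_framed_functor (SS X))
    (comp_framed_functor (coaction_framed_functor G_exact G_surj HSG)
       (action_framed_functor F_exact F_surj HSF)) eta (U eta)).
  exists (@thin_framed_trans _ _ HA _ _
    (comp_framed_functor (action_framed_functor F_exact F_surj HSF)
       (coaction_framed_functor G_exact G_surj HSG))
    (id_framed_functor (coop (SS A))) eps (V eps)).
  split.
  + destruct (nat_trans_inverse Ieta) as [theta Htheta].
    apply (@thin_framed_trans_invertible (SS X) (SS X) HX _ _ _ _ _ theta); [exact Htheta|].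
    intros K L M x y.
    exact (@unit_inverse_cell _ _ _ _ G_exact _ _ HSF HSG _ (Heta eta) theta _ _ M x y Htheta).
  + destruct (nat_trans_inverse Ieps) as [theta Htheta].
    apply (@thin_framed_trans_invertible (coop (SS A)) (coop (SS A)) HA _ _ _ _ _ theta);
      [exact Htheta|].
    intros K L M x y.
    refine (@unit_inverse_cell _ _ _ _ F_exact _ _ HSG HSF _ (Heps eps) theta _ _ M x y _).
    (* Composition in [op A] is reversed, so the two inverse laws trade places in [A]. *)
    intros B; destruct (Htheta B) as [H1 H2]; split; assumption.
Qed.
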